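(* Let $s,l,m,\delta_1,\delta_2$ be Lax data on $\mathbb{Z}^2$ (as defined in the context) whose Lax matrices satisfy $M_1L=L_2M$ for all $\lambda>0$. Let $\Phi=\Phi(k,\ell,\lambda)$ be a solution of $\Phi_1=L\Phi$, $\Phi_2=M\Phi$ with values in the nonzero quaternions, depending smoothly on $\lambda=e^t$, and let $$f=2\left[\Phi^{-1}\frac{\partial}{\partial t}\Phi\right]^{\mathrm{tr}=0},\qquad n=-i\,\Phi^{-1}\sigma_3\Phi,\qquad \lambda=e^t .$$ Then $f$ (with Gauss map $n$) has Gauss curvature $K=-1$ on its quadrilaterals for all values of the spectral parameter $\lambda=e^t$, $t\in\mathbb{R}$. Moreover, $f$ is circular if $\lambda=1$, i.e. for $\lambda=1$ the four vertices $f,f_1,f_{12},f_2$ of each quadrilateral lie on a circle.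
   Context: Quaternions: $\mathbb{H}$ is the real span of the $2\times2$ matrices $\mathbb{1},-i\sigma_1,-i\sigma_2,-i\sigma_3$, where $\sigma_1=\begin{pmatrix}0&1\\1&0\end{pmatrix}$, $\sigma_2=\begin{pmatrix}0&-i\\i&0\end{pmatrix}$, $\sigma_3=\begin{pmatrix}1&0\\0&-1\end{pmatrix}$. $\mathbb{R}^3$ is identified with the imaginary (trace-free) quaternions by $(x_1,x_2,x_3)\leftrightarrow\sum_j x_j(-i\sigma_j)$, and $[X]^{\mathrm{tr}=0}$ is the trace-free part of $X\in\mathbb{H}$. Shift notation: for a map $g$ on $\mathbb{Z}^2$, $g=g(k,\ell)$, $g_1=g(k+1,\ell)$, $g_2=g(k,\ell+1)$, $g_{12}=g(k+1,\ell+1)$. (For $\delta_1,\delta_2$ the index is a label, not a shift.) Lax data: a function $s:\mathbb{Z}^2\to\{z\in\mathbb{C}:|z|=1\}$ on vertices; nonzero complex functions $l$ and $m$ on the edges in the first and second lattice direction ($l(k,\ell)$ sits on the edge from $(k,\ell)$ to $(k+1,\ell)$, $m(k,\ell)$ on the edge from $(k,\ell)$ to $(k,\ell+1)$); parameters $\delta_1$ (constant in the second lattice direction) and $\delta_2$ (constant in the first lattice direction), each of which is either real (with $\tan\frac{\delta_i}2\ne0$ finite) or complex with $\sin\delta_i$ real and $>1$ (in which case $|\tan\frac{\delta_i}{2}|=1$). All these are independent of the spectral parameter $\lambda=e^t>0$. The Lax matrices are $$L=\begin{pmatrix}\cot\frac{\delta_1}2\frac{l}{s}+\tan\frac{\delta_1}2\,l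 s_1& i(\lambda-\frac{ss_1}{\lambda})\\ i(\lambda-\frac{1}{\lambda ss_1})&\cot\frac{\delta_1}2\frac{s}{l}+\tan\frac{\delta_1}2\frac{1}{l s_1}\end{pmatrix},\quad M=\begin{pmatrix}\cot\frac{\delta_2}2\frac{m}{s}+\tan\frac{\delta_2}2\,m s_2& i(\lambda-\frac{ss_2}{\lambda})\\ i(\lambda-\frac{1}{\lambda ss_2})&\cot\frac{\delta_2}2\frac{s}{m}+\tan\frac{\delta_2}2\frac{1}{m s_2}\end{pmatrix}.$$ The moduli of $l,m$ are required to be such that $L,M$ are quaternions: with $s=e^{i\rho}$, $s_i=e^{i\rho_i}$, the modulus of $l$ (for $i=1$), resp. $m$ (for $i=2$), is $$\sqrt{\frac{\cos(\rho_i-\arg\tan\frac{\delta_i}2)+\cos(\rho-\arg\tan\frac{\delta_i}2)}{\cos(\rho_i+\arg\tan\frac{\delta_i}2)+\cos(\rho+\arg\tan\frac{\delta_i}2)}},$$ which equals $1$ when $\tan\frac{\delta_i}2$ is real. Gauss curvature: maps $f:\mathbb{Z}^2\to\mathbb{R}^3$, $n:\mathbb{Z}^2\to\mathbb{S}^2$ form an edge-constraint net if $f_i-f\perp n_i+n$ on all edges ($i=1,2$). For a quadrilateral, a face normal is a unit vector $N\perp\mathrm{span}\{n_{12}-n,\,n_2-n_1\}$, and $$K=\frac{\det(n_{12}-n,\,n_2-n_1,\,N)}{\det(f_{12}-f,\,f_2-f_1,\,N)},$$ defined for quadrilaterals for which the denominator does not vanish. Straight lines are regarded as degenerate circles.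
   Formalization: K = -1 is claimed only on quadrilaterals where n12-n and n2-n1 are linearly independent, so that the face normal is unique up to sign; where they are parallel the numerator vanishes and K would be 0 whenever the denominator is nonzero. *)

(* Defs.v *)
From mathcomp Require Import all_boot all_order all_algebra.
From mathcomp Require Import all_classical all_reals all_analysis.
From mathcomp Require Import complex.

Set Implicit Arguments.
Unset Strict Implicit.
Unset Printing Implicit Defensive.

Import Order.TTheory GRing.Theory Num.Theory.
Import numFieldNormedType.Exports.

Local Open Scope classical_set_scope.
Local Open Scope ring_scope.
Local Open Scope complex_scope.

Definition cis (R : realType) (x : R) : R[i] := cos x +i* sin x.

Definition cexp (R : realType) (z : R[i]) : R[i] :=
  (expR (complex.Re z))%:C * cis (complex.Im z).

Definition csin (R : realType) (z : R[i]) : R[i] :=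
  (cexp ('i%C * z) - cexp (- ('i%C * z))) / (2%:R * 'i%C).

Definition ccos (R : realType) (z : R[i]) : R[i] :=
  (cexp ('i%C * z) + cexp (- ('i%C * z))) / 2%:R.

Definition ctan (R : realType) (z : R[i]) : R[i] := csin z / ccos z.

Definition ccot (R : realType) (z : R[i]) : R[i] := ccos z / csin z.

(* a is an argument of z, i.e. a value of arg z modulo 2 pi *)
Definition is_arg (R : realType) (a : R) (z : R[i]) : Prop :=
  z = `|z| * cis a.

Definition mx2 (K : Type) (a b c d : K) : 'M[K]_2 :=
  \matrix_(i < 2, j < 2)
    if i == 0 then (if j == 0 then a else b) else (if j == 0 then c else d).

Definition sigma1 (R : realType) : 'M[R[i]]_2 := mx2 0 1 1 0.
Definition sigma2 (R : realType) : 'M[R[i]]_2 := mx2 0 (- 'i%C) 'i%C 0.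
Definition sigma3 (R : realType) : 'M[R[i]]_2 := mx2 1 0 0 (- 1).

Definition iquat (R : realType) (x : 'rV[R]_3) : 'M[R[i]]_2 :=
    (x 0 0)%:C *: (- 'i%C *: sigma1 R)
  + (x 0 1)%:C *: (- 'i%C *: sigma2 R)
  + (x 0 2%:R)%:C *: (- 'i%C *: sigma3 R).

Definition quaternion (R : realType) (X : 'M[R[i]]_2) : Prop :=
  exists (a : R) (x : 'rV[R]_3), X = (a%:C)%:M + iquat x.

Definition trace_free_part (R : realType) (X : 'M[R[i]]_2) : 'M[R[i]]_2 :=
  X - (\tr X / 2%:R)%:M.

Definition mx_smooth_pos (R : realType) (F : R -> 'M[R[i]]_2) : Prop :=
  forall (i j : 'I_2) (n : nat) (x : R), 0 < x ->
    derivable (derive1n n (fun y => complex.Re (F y i j))) x 1 /\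
    derivable (derive1n n (fun y => complex.Im (F y i j))) x 1.

Definition mx_derive (R : realType) (F : R -> 'M[R[i]]_2) (t : R) :
    'M[R[i]]_2 :=
  \matrix_(i, j) (derive1 (fun u => complex.Re (F u i j)) t
              +i* derive1 (fun u => complex.Im (F u i j)) t).

(* z is the variable on the edge whose end points carry s and s';
   L and M both have this form *)
Definition lax_matrix (R : realType) (delta z s s' : R[i]) (lambda : R) :
    'M[R[i]]_2 :=
  let T := ctan (delta / 2%:R) in
  let Ct := ccot (delta / 2%:R) in
  let la := lambda%:C in
  mx2 (Ct * (z / s) + T * (z * s'))   ('i%C * (la - s * s' / la))
      ('i%C * (la - 1 / (la * s * s'))) (Ct * (s / z) + T * (1 / (z * s'))).

Definition laxL (R : realType) (s l : int -> int -> R[i]) (delta1 : int -> R[i])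
    (j k : int) (lambda : R) : 'M[R[i]]_2 :=
  lax_matrix (delta1 j) (l j k) (s j k) (s (j + 1) k) lambda.

Definition laxM (R : realType) (s m : int -> int -> R[i]) (delta2 : int -> R[i])
    (j k : int) (lambda : R) : 'M[R[i]]_2 :=
  lax_matrix (delta2 k) (m j k) (s j k) (s j (k + 1)) lambda.

Definition lax_parameter (R : realType) (delta : R[i]) : Prop :=
  [/\ complex.Im delta = 0, ccos (delta / 2%:R) != 0
    & ctan (delta / 2%:R) != 0]
  \/ (complex.Im (csin delta) = 0 /\ 1 < complex.Re (csin delta)).

(* The quotient is invariant under changing rho, rho', alpha by multiples of
   2 pi. It is only imposed where its denominator does not vanish; for real
   tan (delta / 2) the modulus is 1 throughout. *)
Definition edge_modulus (R : realType) (delta z s s' : R[i]) : Prop :=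
  let T := ctan (delta / 2%:R) in
  (complex.Im T = 0 -> `|z| = 1) /\
  (forall rho rho' alpha : R,
     s = cis rho -> s' = cis rho' -> is_arg alpha T ->
     let num := cos (rho' - alpha) + cos (rho - alpha) in
     let den := cos (rho' + alpha) + cos (rho + alpha) in
     den != 0 -> `|z| = (Num.sqrt (num / den))%:C).

Record lax_data (R : realType) (s l m : int -> int -> R[i])
    (delta1 delta2 : int -> R[i]) : Prop := LaxData {
  lax_s_unit : forall j k, `|s j k| = 1;
  lax_l_neq0 : forall j k, l j k != 0;
  lax_m_neq0 : forall j k, m j k != 0;
  lax_delta1 : forall j, lax_parameter (delta1 j);
  lax_delta2 : forall k, lax_parameter (delta2 k);
  lax_L_quat : forall j k lambda, 0 < lambda ->
    quaternion (laxL s l delta1 j k lambda);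
  lax_M_quat : forall j k lambda, 0 < lambda ->
    quaternion (laxM s m delta2 j k lambda);
  lax_l_mod : forall j k,
    edge_modulus (delta1 j) (l j k) (s j k) (s (j + 1) k);
  lax_m_mod : forall j k,
    edge_modulus (delta2 k) (m j k) (s j k) (s j (k + 1))
}.

Definition net (R : realType) := int -> int -> 'rV[R]_3.

Definition dot (R : realType) (u v : 'rV[R]_3) : R := \sum_i u 0 i * v 0 i.

Definition det3 (R : realType) (u v w : 'rV[R]_3) : R :=
  \det (\matrix_(i < 3, j < 3) (nth 0 [:: u; v; w] i) 0 j).

Definition edge_constraint_net (R : realType) (f n : net R) : Prop :=
  forall j k,
    [/\ dot (n j k) (n j k) = 1,
        dot (f (j + 1) k - f j k) (n (j + 1) k + n j k) = 0
      & dot (f j (k + 1) - f j k) (n j (k + 1) + n j k) = 0].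

(* g_12 - g and g_2 - g_1 *)
Definition diag12 (R : realType) (g : net R) (j k : int) : 'rV[R]_3 :=
  g (j + 1) (k + 1) - g j k.
Definition diag21 (R : realType) (g : net R) (j k : int) : 'rV[R]_3 :=
  g j (k + 1) - g (j + 1) k.

Definition face_normal (R : realType) (n : net R) (j k : int) (N : 'rV[R]_3) :
    Prop :=
  [/\ dot N N = 1, dot N (diag12 n j k) = 0 & dot N (diag21 n j k) = 0].

Definition gauss_den (R : realType) (f : net R) (j k : int) (N : 'rV[R]_3) : R :=
  det3 (diag12 f j k) (diag21 f j k) N.

Definition gauss_curvature (R : realType) (f n : net R) (j k : int)
    (N : 'rV[R]_3) : R :=
  det3 (diag12 n j k) (diag21 n j k) N / gauss_den f j k N.

(* The face normal, hence K, is determined (up to the sign of N, on which K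
   does not depend) exactly when the two diagonals of n span a plane. If they
   are parallel, the numerator vanishes for every admissible N. *)
Definition has_gauss_curvature (R : realType) (f n : net R) (K : R) : Prop :=
  edge_constraint_net f n /\
  forall j k N,
    \rank (col_mx (diag12 n j k) (diag21 n j k)) = 2%N ->
    face_normal n j k N -> gauss_den f j k N != 0 ->
    gauss_curvature f n j k N = K.

Definition is_circle (R : realType) (C : set 'rV[R]_3) : Prop :=
  exists (c nu : 'rV[R]_3) (r : R), [/\ nu != 0, 0 < r &
    C = [set x | dot (x - c) nu = 0 /\ dot (x - c) (x - c) = r ^+ 2]].

Definition is_line (R : realType) (C : set 'rV[R]_3) : Prop :=
  exists p v : 'rV[R]_3, v != 0 /\ C = [set p + a *: v | a in [set: R]].

Definition circular_net (R : realType) (f : net R) : Prop :=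
  forall j k, exists C : set 'rV[R]_3, (is_circle C \/ is_line C) /\
    [/\ C (f j k), C (f (j + 1) k), C (f (j + 1) (k + 1)) & C (f j (k + 1))].

(* Main.v *)
Require Import Defs.
From mathcomp Require Import all_boot all_order all_algebra.
From mathcomp Require Import all_classical all_reals all_analysis.
From mathcomp Require Import complex ring lra.
Import Order.TTheory GRing.Theory Num.Theory.
Import numFieldNormedType.Exports.
Local Open Scope classical_set_scope.
Local Open Scope ring_scope.
Local Open Scope complex_scope.

(** Write a quaternion as [quat w v], with first row (w, v).  A Lax matrix is
    [quat a b] with a independent of la and b = i (la - sigma / la), where
    sigma = s s1 is the product of the values of s at the ends of its edge.
    Since cot * tan = 1, the unknown l cancels from |a|^2 = k + 2 Re sigma,
    k = tan^2 + cot^2, and the norm of the matrix is k + x with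
    x = la^2 + la^-2: opposite edges of a quadrilateral carry the same norm.

    Inner products of imaginary quaternions are traces, hence invariant under
    conjugation by the frame.  If a frame P is carried to X P, up to a real
    factor, then all products of the increments of f and n depend on X and its
    t-derivative only ([transport_dots]).  This covers the edges, where X is a
    Lax matrix and the edge constraint drops out because the derivative of X
    has no diagonal, and also the two diagonals, where X is M_1 L or M L^*.

    Curvature.  Let U, V be the diagonals of n, and F, G those of f.  A unit
    normal N to U and V gives det(U,V,N)^2 = |U|^2 |V|^2 - (U.V)^2 and
    det(U,V,N) det(F,G,N) = (F.U)(G.V) - (F.V)(G.U), so K = -1 amounts to the
    vanishing of the sum of these two expressions ([curvature_of_gram]).  The
    edge constraints give F.V = G.U and reduce F.V, like U.V, to edge
    quantities.  The off-diagonal entries of the two diagonal transports are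
    i (la p - q / la) and i (la pZ - qZ / la), and compatibility yields
    p pZ = h, p qZ + q pZ = - g and p pZ^* = q qZ^*, where h and g are
    polynomials in the values of s and the two constants k, and U.V + i F.V is a real
    multiple of x h + g.  With these three relations the required identity is
    [spectral_identity], valid for every la ([face_gram_identity]).

    Circles.  At la = 1 the matrix L^-1 L' is already trace-free and equals
    L' L up to a real factor, so that f_1 - f is a real multiple of
    Phi^-1 L' Phi_1.  Products of consecutive edges therefore telescope:
    (f_1 - f)(f_12 - f_1) is a real multiple of Phi^-1 (L' M_1') Phi_12.  The
    matrix L' M_1' is diagonal, and the argument of its first entry is that of
    the square root of s / s_12, modulo pi.  The path through f_2 leads to the
    same argument, so the two products of consecutive edges are real multiples
    of each other; that is the quaternionic cross-ratio criterion for four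
    points on a circle or a line ([on_circle_or_line_of_product]). *)

Set Implicit Arguments.
Unset Strict Implicit.

(** * Quaternions as 2x2 matrices *)

Definition quat (R : realType) (w v : R[i]) : 'M[R[i]]_2 := mx2 w v (- v^*%C) w^*%C.

Lemma conjc_i (R : realType) : ('i%C : R[i])^*%C = - 'i%C.
Proof. by apply/eqP; rewrite eq_complex /= oppr0 !eqxx. Qed.

Lemma mulcii (R : realType) : 'i%C * 'i%C = -1 :> R[i].
Proof. by rewrite -expr2 sqr_i. Qed.

Lemma conjcVE (R : realType) (x : R[i]) : (x^-1)^*%C = (x^*%C)^-1.
Proof. exact: conjc_inv. Qed.

Lemma conjcDE (R : realType) (x y : R[i]) : (x + y)^*%C = x^*%C + y^*%C.
Proof. exact: (rmorphD (@conjc R)). Qed.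

Lemma conjcME (R : realType) (x y : R[i]) : (x * y)^*%C = x^*%C * y^*%C.
Proof. exact: (rmorphM (@conjc R)). Qed.

Lemma conjcNE (R : realType) (x : R[i]) : (- x)^*%C = - x^*%C.
Proof. exact: (rmorphN (@conjc R)). Qed.

(** Pushes complex conjugation down to the atoms; at a unimodular atom the
    conjugate is then replaced by the inverse, which makes all identities below
    rational. *)
Definition conjcE (R : realType) :=
  (@conjcDE R, @conjcME R, @conjcNE R, @conjcVE R, @conjc_i R, @conjcK R,
   @conjc0 R, @conjc1 R, @conjc_real R).

Lemma conjc_invM (R : realType) (x y : R[i]) :
  x^*%C = x^-1 -> y^*%C = y^-1 -> (x * y)^*%C = (x * y)^-1.
Proof. by rewrite conjcME invfM => -> ->. Qed.

Lemma mx2P (K : Type) (A : 'M[K]_2) : A = mx2 (A 0 0) (A 0 1) (A 1 0) (A 1 1).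
Proof.
apply/matrixP => i j; rewrite mxE.
by case: i j => [[|[|//]] ?] [[|[|//]] ?] /=; congr (A _ _); apply: val_inj.
Qed.

Lemma mx2_inj (K : Type) (a b c d a' b' c' d' : K) :
  mx2 a b c d = mx2 a' b' c' d' -> [/\ a = a', b = b', c = c' & d = d'].
Proof.
move=> e; have h i j : mx2 a b c d i j = mx2 a' b' c' d' i j by rewrite e.
by move: (h 0 0) (h 0 1) (h 1 0) (h 1 1); rewrite !mxE.
Qed.

Lemma mx2M (K : pzRingType) (a b c d a' b' c' d' : K) :
  mx2 a b c d *m mx2 a' b' c' d' =
  mx2 (a * a' + b * c') (a * b' + b * d') (c * a' + d * c') (c * b' + d * d').
Proof.
by rewrite [LHS]mx2P !mxE !big_ord_recl !big_ord0 /= !mxE /= !addr0.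
Qed.

Lemma mx2D (K : pzRingType) (a b c d a' b' c' d' : K) :
  mx2 a b c d + mx2 a' b' c' d' = mx2 (a + a') (b + b') (c + c') (d + d').
Proof. by rewrite [LHS]mx2P !mxE. Qed.

Lemma mx2Z (K : pzRingType) (k a b c d : K) :
  k *: mx2 a b c d = mx2 (k * a) (k * b) (k * c) (k * d).
Proof. by rewrite [LHS]mx2P !mxE. Qed.

Lemma mx2_scalar (K : pzRingType) (k : K) : k%:M = mx2 k 0 0 k.
Proof. by rewrite [LHS]mx2P !mxE /= !mulr1n !mulr0n. Qed.

Lemma mxtrace_mx2 (K : pzRingType) (a b c d : K) : \tr (mx2 a b c d) = a + d.
Proof. by rewrite /mxtrace !big_ord_recl big_ord0 !mxE /= addr0. Qed.

Lemma quat_inj (R : realType) (w v w' v' : R[i]) :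
  quat w v = quat w' v' -> w = w' /\ v = v'.
Proof. by move=> e; have [] := mx2_inj e. Qed.

Lemma quatM (R : realType) (w v w' v' : R[i]) :
  quat w v *m quat w' v' = quat (w * w' - v * v'^*%C) (w * v' + v * w'^*%C).
Proof. by rewrite /quat mx2M !conjcE; congr mx2; ring. Qed.

Lemma quatD (R : realType) (w v w' v' : R[i]) :
  quat w v + quat w' v' = quat (w + w') (v + v').
Proof. by rewrite /quat mx2D !conjcE opprD. Qed.

Lemma quatZ (R : realType) (k : R) (w v : R[i]) :
  k%:C *: quat w v = quat (k%:C * w) (k%:C * v).
Proof. by rewrite /quat mx2Z !conjcE mulrN. Qed.

Lemma quat_starl (R : realType) (w v : R[i]) :
  quat w^*%C (- v) *m quat w v = (w * w^*%C + v * v^*%C)%:M.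
Proof. by rewrite quatM mx2_scalar /quat !conjcE; congr mx2; ring. Qed.

Lemma quat_starr (R : realType) (w v : R[i]) :
  quat w v *m quat w^*%C (- v) = (w * w^*%C + v * v^*%C)%:M.
Proof. by rewrite quatM mx2_scalar /quat !conjcE; congr mx2; ring. Qed.

Lemma mx2_0 (K : pzRingType) : mx2 0 0 0 0 = 0 :> 'M[K]_2.
Proof. by rewrite [RHS]mx2P !mxE. Qed.

Lemma quat_unit_norm (R : realType) (w v : R[i]) :
  quat w v \in unitmx -> w * w^*%C + v * v^*%C != 0.
Proof.
move=> U; apply/eqP => D0; have := quat_starl w v.
rewrite D0 mx2_scalar mx2_0 => e.
have : quat w^*%C (- v) = 0 by rewrite -[LHS](mulmxK U) e mul0mx.
rewrite -mx2_0 => /(@mx2_inj R[i] _ _ _ _ _ _ _ _)[_ /eqP + _].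
rewrite conjcK oppr_eq0 => /eqP v0 w0; move: U.
by rewrite v0 w0 /quat !conjcE oppr0 mx2_0 unitmxE det0 unitr0.
Qed.

Lemma invmx_quat (R : realType) (w v : R[i]) :
  quat w v \in unitmx ->
  invmx (quat w v) = (w * w^*%C + v * v^*%C)^-1 *: quat w^*%C (- v).
Proof.
move=> U; have D := quat_unit_norm U.
rewrite -[LHS]mulmx1.
have -> : 1%:M = (w * w^*%C + v * v^*%C)^-1 *: (quat w v *m quat w^*%C (- v)).
  by rewrite quat_starr -mul_scalar_mx -scalar_mxM mulVf.
by rewrite -scalemxAr mulmxA mulVmx // mul1mx.
Qed.

Lemma quat_neq0_unit (R : realType) (w v : R[i]) :
  quat w v <> 0 -> quat w v \in unitmx.
Proof.
move=> X0; rewrite unitmxE unitfE; apply/eqP => D0; apply: X0.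
have : \det (quat w v) = w * w^*%C + v * v^*%C.
  rewrite (expand_det_row _ 0) !big_ord_recl big_ord0 /cofactor !det_mx11 !mxE /=.
  by rewrite !expr0 /= /bump /=; ring.
rewrite D0 => /esym/eqP; rewrite paddr_eq0 ?mulcJ_ge0 // !mulf_eq0 !conjc_eq0 !orbb.
case/andP => /eqP -> /eqP ->.
by rewrite /quat !conjcE oppr0 mx2_0.
Qed.

Lemma iquatE (R : realType) (x : 'rV[R]_3) :
  iquat x = quat (- 'i%C * (x 0 2%:R)%:C) (- 'i%C * (x 0 0)%:C - (x 0 1)%:C).
Proof.
rewrite /iquat /sigma1 /sigma2 /sigma3 !mx2Z !mx2D /quat !conjcE.
have i2 := mulcii R.
congr mx2; rewrite ?mulNr ?mulrN ?i2; ring.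
Qed.

Lemma quaternionP (R : realType) (X : 'M[R[i]]_2) :
  quaternion X -> exists w v, X = quat w v.
Proof.
case=> a [x ->]; rewrite iquatE.
exists (a%:C + - 'i%C * (x 0 2%:R)%:C), (- 'i%C * (x 0 0)%:C - (x 0 1)%:C).
have -> : a%:C%:M = quat a%:C 0 by rewrite mx2_scalar /quat !conjcE oppr0.
by rewrite quatD add0r.
Qed.

Lemma dotE3 (R : realType) (x y : 'rV[R]_3) :
  dot x y = x 0 0 * y 0 0 + x 0 1 * y 0 1 + x 0 2%:R * y 0 2%:R.
Proof.
rewrite /dot !big_ord_recl big_ord0 addr0 addrA.
have -> : lift ord0 ord0 = 1 :> 'I_3 by apply: val_inj.
by have -> : lift ord0 (lift ord0 ord0) = 2%:R :> 'I_3 by apply: val_inj.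
Qed.

(** By the Pauli relations the product of two imaginary quaternions has scalar part
    - x . y, and the trace reads off that part. *)
Lemma dot_trace (R : realType) (x y : 'rV[R]_3) :
  (dot x y)%:C = - (\tr (iquat x *m iquat y) / 2%:R).
Proof.
rewrite !iquatE quatM mxtrace_mx2 !conjcE dotE3 !rmorphD !rmorphM /=.
have i2 : 'i%C ^+ 2 = -1 :> R[i] by rewrite sqr_i.
apply/subr0_eq; transitivity (('i%C ^+ 2 + 1) *
  ((x 0 0)%:C * (y 0 0)%:C + (x 0 2%:R)%:C * (y 0 2%:R)%:C)); first by field.
by rewrite i2 addNr mul0r.
Qed.

(** * Increments of position and normal along a transport of frames *)

(** The Sym formula for the surface: [dP] stands for the derivative of the frame
    [P] in t. *)
Definition frame_position (R : realType) (P dP : 'M[R[i]]_2) : 'M[R[i]]_2 :=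
  2%:R *: trace_free_part (invmx P *m dP).

Definition frame_normal (R : realType) (P : 'M[R[i]]_2) : 'M[R[i]]_2 :=
  - 'i%C *: (invmx P *m sigma3 R *m P).

Lemma frame_normalE (R : realType) (P : 'M[R[i]]_2) :
  frame_normal P = invmx P *m quat (- 'i%C) 0 *m P.
Proof.
rewrite /frame_normal scalemxAl scalemxAr.
have -> // : - 'i%C *: sigma3 R = quat (- 'i%C) 0.
by rewrite /sigma3 mx2Z /quat !conjcE; congr mx2; ring.
Qed.

Lemma mxtrace_conj (K : comUnitRingType) (P A : 'M[K]_2) :
  P \in unitmx -> \tr (invmx P *m A *m P) = \tr A.
Proof. by move=> U; rewrite mxtrace_mulC mulmxA mulmxV // mul1mx. Qed.

Lemma quatN (R : realType) (w v : R[i]) : quat (- w) (- v) = - quat w v.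
Proof. by rewrite [RHS]mx2P !mxE /= /quat !conjcE. Qed.

Lemma conj_mulmx (K : comUnitRingType) (P A B : 'M[K]_2) : P \in unitmx ->
  (invmx P *m A *m P) *m (invmx P *m B *m P) = invmx P *m (A *m B) *m P.
Proof. by move=> UP; rewrite !mulmxA mulmxK. Qed.

Lemma iquatB (R : realType) (x y : 'rV[R]_3) :
  iquat (x - y) = iquat x - iquat y.
Proof.
by rewrite !iquatE -quatN quatD !mxE !rmorphB /=; congr quat; ring.
Qed.

Lemma invmx_transport (K : fieldType) (P Pp X : 'M[K]_2) (r : K)
    (r0 : r != 0) (UP : P \in unitmx) (UX : X \in unitmx)
    (eP : r *: Pp = X *m P) :
  Pp \in unitmx /\ invmx Pp = r *: (invmx P *m invmx X).
Proof.
have UPp : Pp \in unitmx.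
  have : r *: Pp \in unitmx by rewrite eP unitmx_mul UX UP.
  by rewrite unitmxZ // unitfE.
split=> //.
have E : r *: (invmx P *m invmx X) *m Pp = 1%:M.
  rewrite -scalemxAl scalemxAr eP -mulmxA (mulmxA (invmx X)) mulVmx //.
  by rewrite mul1mx mulVmx.
by rewrite -[LHS]mul1mx -E mulmxK.
Qed.

(** The factor r only contributes a scalar matrix, which the trace-free part
    discards; so a transport is needed up to a scalar factor only. *)
Lemma transport_velocity (R : realType) (P Pp dP dPp X dX : 'M[R[i]]_2) (r dr : R[i])
    (r0 : r != 0) (UP : P \in unitmx) (UX : X \in unitmx)
    (eP : r *: Pp = X *m P)
    (edP : dr *: Pp + r *: dPp = dX *m P + X *m dP) :
  invmx Pp *m dPp =
  invmx P *m dP + invmx P *m (invmx X *m dX) *m P - (r^-1 * dr)%:M.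
Proof.
have [UPp iPp] := invmx_transport r0 UP UX eP.
have -> : dPp = r^-1 *: (dX *m P + X *m dP) - (r^-1 * dr) *: Pp.
  by rewrite -edP scalerDr !scalerA mulVf // scale1r addrAC subrr add0r.
rewrite mulmxBr -scalemxAr -[in X in _ - X]scalemxAr mulVmx // scalemx1.
congr (_ - _); rewrite iPp -scalemxAl scalerA mulVf // scale1r mulmxDr addrC.
by rewrite -!mulmxA (mulmxA (invmx X) X) mulVmx // mul1mx.
Qed.

Lemma frame_normal_transport (R : realType) (P Pp X : 'M[R[i]]_2) (r : R[i])
    (r0 : r != 0) (UP : P \in unitmx) (UX : X \in unitmx)
    (eP : r *: Pp = X *m P) :
  frame_normal Pp = invmx P *m (invmx X *m quat (- 'i%C) 0 *m X) *m P.
Proof.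
have [UPp iPp] := invmx_transport r0 UP UX eP.
rewrite frame_normalE iPp -!scalemxAl scalemxAr eP.
by rewrite !mulmxA.
Qed.

Lemma mxtrace_tracefree (R : realType) (A B : 'M[R[i]]_2) :
  \tr B = 0 -> \tr (trace_free_part A *m B) = \tr (A *m B).
Proof.
move=> B0; rewrite /trace_free_part mulmxBl raddfB /= mul_scalar_mx mxtraceZ.
by rewrite B0 mulr0 subr0.
Qed.

Lemma frame_normal_unit (R : realType) (P : 'M[R[i]]_2) (y : 'rV[R]_3) :
  P \in unitmx -> iquat y = frame_normal P -> dot y y = 1.
Proof.
move=> UP hy; apply: (@complexI R).
rewrite dot_trace hy frame_normalE conj_mulmx // mxtrace_conj // quatM.
rewrite mulrNN -expr2 sqr_i !(mulr0, mul0r, subr0, addr0) mxtrace_mx2 !conjcE.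
by field.
Qed.

(** Both increments are conjugated by the same frame, which disappears from the
    traces; what remains depends on the transport alone. *)
Lemma transport_dots (R : realType) (P Pp dP dPp : 'M[R[i]]_2)
    (w v dw dv r dr : R[i]) (x xp y yp : 'rV[R]_3) (D := w * w^*%C + v * v^*%C)
    (r0 : r != 0) (UP : P \in unitmx) (UX : quat w v \in unitmx)
    (eP : r *: Pp = quat w v *m P)
    (edP : dr *: Pp + r *: dPp = quat dw dv *m P + quat w v *m dP)
    (hx : iquat x = frame_position P dP) (hxp : iquat xp = frame_position Pp dPp)
    (hy : iquat y = frame_normal P) (hyp : iquat yp = frame_normal Pp) :
  [/\ (dot y yp)%:C = 1 - 2%:R * (v * v^*%C) / D,
      (dot (xp - x) y)%:C =
        'i%C * (w^*%C * dw - w * dw^*%C + v * dv^*%C - v^*%C * dv) / D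
    & (dot (xp - x) yp)%:C =
        'i%C * (w^*%C * dw - w * dw^*%C + v^*%C * dv - v * dv^*%C) / D].
Proof.
have D0 : D != 0 by exact: quat_unit_norm UX.
have i2 := mulcii R.
have trk : \tr (quat (- 'i%C : R[i]) 0) = 0.
  by rewrite mxtrace_mx2 !conjcE opprK addNr.
have hyp' := frame_normal_transport r0 UP UX eP.
have trN (A B : 'M[R[i]]_2) : A \in unitmx -> \tr B = 0 ->
    \tr (invmx A *m B *m A) = 0 by move=> UA; rewrite mxtrace_conj.
have trXk : \tr (invmx (quat w v) *m quat (- 'i%C) 0 *m quat w v) = 0 by rewrite trN.
have dE (B : 'M[R[i]]_2) : \tr B = 0 ->
  \tr ((frame_position Pp dPp - frame_position P dP) *m (invmx P *m B *m P)) =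
  2%:R * \tr (invmx (quat w v) *m quat dw dv *m B).
  move=> B0; have B0' := trN _ _ UP B0.
  rewrite /frame_position -scalerBr -scalemxAl mxtraceZ; congr (_ * _).
  rewrite mulmxBl raddfB /= !mxtrace_tracefree //.
  rewrite (transport_velocity r0 UP UX eP edP) mulmxBl mulmxDl raddfB raddfD /=.
  rewrite mul_scalar_mx mxtraceZ B0' mulr0 subr0 addrC addKr.
  by rewrite conj_mulmx // mxtrace_conj.
have iX := invmx_quat UX; rewrite -/D in iX.
split.
- rewrite dot_trace hy hyp hyp' frame_normalE conj_mulmx // mxtrace_conj //.
  rewrite iX -!(scalemxAl, scalemxAr) mxtraceZ !quatM mxtrace_mx2 !conjcE.
  apply/subr0_eq; transitivity (- ('i%C * 'i%C + 1) *
    (w * w^*%C - v * v^*%C) / D); first by rewrite /D in D0 *; field.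
  by rewrite i2 addNr oppr0 !mul0r.
- rewrite dot_trace iquatB hx hxp hy frame_normalE dE // iX -!scalemxAl mxtraceZ.
  rewrite !quatM mxtrace_mx2 !conjcE.
  by field.
- rewrite dot_trace iquatB hx hxp hyp hyp' dE //.
  rewrite -!(mulmxA (invmx (quat w v))) mxtrace_mulC !mulmxA mulmxK // iX.
  rewrite -!(scalemxAl, scalemxAr) mxtraceZ !quatM mxtrace_mx2 !conjcE.
  by field.
Qed.

(** * Algebra of the compatibility relations *)

(** Here and in the next three lemmas, ac, alc, ... stand for the conjugates of
    a, al, ....  The two factors are the coefficients p and pZ of la in the
    diagonal transports.  In the product of p = al1 + ac with pZ, the difference
    pZ is written through the adjacent edges in each term so that only |a|^2,
    |al1|^2 and the combination of [E3] appear. *)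
Lemma diagonal_product (F : fieldType) (s s1 s2 s12 a ac al a2c al1 al1c k1 k2 : F)
    (hs : s != 0) (hs1 : s1 != 0) (hs2 : s2 != 0) (hs12 : s12 != 0)
    (E1c : al1c + a = a2c + al)
    (E3 : al * ac - a2c * al1 =
          s * s2 + (s * s1)^-1 - s2 * s12 - (s1 * s12)^-1)
    (ka : a * ac = k1 + s * s1 + (s * s1)^-1)
    (kal1 : al1 * al1c = k2 + s1 * s12 + (s1 * s12)^-1) :
  (al1 + ac) * (a - al) = k1 - k2 + s * s1 - s * s2 + s2 * s12 - s1 * s12.
Proof.
have -> : a - al = a2c - al1c by rewrite -[a](addKr al1c) E1c; ring.
have -> : (al1 + ac) * (a2c - al1c) =
  a * ac - al1 * al1c - (al * ac - a2c * al1) + ac * (a2c + al - (al1c + a)).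
  by ring.
by rewrite ka kal1 E3 E1c subrr; field; rewrite ?hs ?hs1 ?hs2 ?hs12.
Qed.

Lemma diagonal_cross_sum (F : fieldType) (s s1 s2 s12 a ac al a2c al1 al1c k1 k2 : F)
    (hs : s != 0) (hs1 : s1 != 0) (hs2 : s2 != 0) (hs12 : s12 != 0)
    (E1c : al1c + a = a2c + al)
    (E2c : al1c / (s * s1) + a / (s1 * s12) =
           a2c / (s * s2) + al / (s2 * s12))
    (E3 : al * ac - a2c * al1 =
          s * s2 + (s * s1)^-1 - s2 * s12 - (s1 * s12)^-1)
    (ka : a * ac = k1 + s * s1 + (s * s1)^-1)
    (kal1 : al1 * al1c = k2 + s1 * s12 + (s1 * s12)^-1) :
  (al1 + ac) * (s * (s2 * a - s1 * al)) +
  (al1 * (s * s1) + ac * (s1 * s12)) * (a - al) =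
  k1 * (s * s2 + s1 * s12) - k2 * (s * s1 + s2 * s12).
Proof.
have e2 : s * (s2 * a - s1 * al) = s12 * (s1 * a2c - s2 * al1c).
  apply/subr0_eq; transitivity (s * s1 * s2 * s12 *
    ((al1c / (s * s1) + a / (s1 * s12)) - (a2c / (s * s2) + al / (s2 * s12)))).
    by field; rewrite ?hs ?hs1 ?hs2 ?hs12.
  by rewrite E2c subrr mulr0.
have e1 : a - al = a2c - al1c by rewrite -[a](addKr al1c) E1c; ring.
transitivity (al1 * (s * (s2 * a - s1 * al)) + ac * (s * (s2 * a - s1 * al)) +
   al1 * (s * s1) * (a - al) + ac * (s1 * s12) * (a - al)); first by ring.
rewrite {1}e2 {1}e1.
transitivity (- s1 * (s + s12) * (al * ac - a2c * al1)
  - al1 * al1c * (s2 * s12 + s * s1) + a * ac * (s * s2 + s1 * s12)).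
  by ring.
by rewrite E3 ka kal1; field; rewrite ?hs ?hs1 ?hs2 ?hs12.
Qed.

(** A consequence of the linear relations alone: after elimination of al1 by [E1]
    the difference of the two sides is - ac / (s s2) times that of [E2].  In terms
    of p, q, pZ and qZ it says that the two terms q pZ and p qZ of the previous
    lemma have a nonnegative ratio, without which the identity below would fail. *)
Lemma diagonal_conj_product (F : fieldType) (s s1 s2 s12 ac alc a2 al1 : F)
    (hs : s != 0) (hs1 : s1 != 0) (hs2 : s2 != 0)
    (E1 : al1 + ac = a2 + alc)
    (E2 : al1 * (s * s1) + ac * (s1 * s12) = a2 * (s * s2) + alc * (s2 * s12)) :
  (al1 + ac) * (ac - alc) =
  (al1 * (s * s1) + ac * (s1 * s12)) * (s^-1 * (ac / s2 - alc / s1)).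
Proof.
have E1' : al1 = a2 + alc - ac by rewrite -E1; ring.
rewrite E1' in E2 *; apply/subr0_eq.
transitivity ((- ac / (s * s2)) *
   ((a2 + alc - ac) * (s * s1) + ac * (s1 * s12) -
     (a2 * (s * s2) + alc * (s2 * s12)))).
  field; rewrite ?hs ?hs1 ?hs2 //.
by rewrite E2 subrr mulr0.
Qed.

(** The coefficients of la^4 and la^2 agree identically; the others differ by
    multiples of the two hypotheses. *)
Lemma spectral_identity (F : fieldType) (la p pc q qc pZ pZc qZ qZc : F)
    (hla : la != 0) (E4 : p * pZc = q * qZc) (E4c : pc * pZ = qc * qZ) :
  (la * p - q / la) * (la * pc - qc / la) *
  ((la * pZ - qZ / la) * (la * pZc - qZc / la))
  - (q * pc - p * qc) * (qZ * pZc - pZ * qZc) =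
  ((la ^+ 2 + la ^- 2) * (p * pZ) - (p * qZ + q * pZ)) *
  ((la ^+ 2 + la ^- 2) * (pc * pZc) - (pc * qZc + qc * pZc)).
Proof.
apply/subr0_eq; transitivity (
  (p * pZc - q * qZc) * (la ^- 2 * (qc * pZ + pc * qZ) - pc * pZ
                         - la ^- 4 * (pc * pZ)) +
  (pc * pZ - qc * qZ) * (la ^- 2 * (q * pZc + p * qZc) - p * pZc
                         - la ^- 4 * (q * qZc))).
  by field.
by rewrite E4 E4c !subrr !mul0r addr0.
Qed.

(** * Curvature from inner products *)

Lemma ord3P (j : 'I_3) : j = 0 \/ (j = 1 \/ j = 2%:R).
Proof.
by case: j => [[|[|[|//]]] p]; [left|right; left|right; right]; exact: val_inj.
Qed.

Lemma det3E (R : realType) (u v w : 'rV[R]_3) :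
  det3 u v w =
  u 0 0 * (v 0 1 * w 0 2%:R - v 0 2%:R * w 0 1)
  - u 0 1 * (v 0 0 * w 0 2%:R - v 0 2%:R * w 0 0)
  + u 0 2%:R * (v 0 0 * w 0 1 - v 0 1 * w 0 0).
Proof.
have o1 : lift ord0 ord0 = 1 :> 'I_3 by apply: val_inj.
have o2 : lift ord0 (lift ord0 ord0) = 2%:R :> 'I_3 by apply: val_inj.
have l1 : lift (1 : 'I_3) (0 : 'I_2) = 0 by apply: val_inj.
have l2 : lift (1 : 'I_3) (1 : 'I_2) = 2%:R by apply: val_inj.
have l3 : lift (2%:R : 'I_3) (0 : 'I_2) = 0 by apply: val_inj.
have l4 : lift (2%:R : 'I_3) (1 : 'I_2) = 1 by apply: val_inj.
have l5 : lift (0 : 'I_3) (0 : 'I_2) = 1 by apply: val_inj.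
have l6 : lift (0 : 'I_3) (1 : 'I_2) = 2%:R by apply: val_inj.
have m1 : lift (0 : 'I_2) (0 : 'I_1) = 1 by apply: val_inj.
have m2 : lift (1 : 'I_2) (0 : 'I_1) = 0 by apply: val_inj.
rewrite /det3 (expand_det_row _ 0) !big_ord_recl big_ord0 o1 o2.
rewrite /cofactor !(expand_det_row _ 0) !big_ord_recl !big_ord0.
rewrite /cofactor !det_mx11 !mxE /= !(l1, l2, l3, l4, l5, l6, m1, m2).
by rewrite /bump /= !expr0 ?expr1; ring.
Qed.

(** A product of determinants is the determinant of the inner products, from
    which the unit vector z, orthogonal to u and v, splits off. *)
Lemma det3_mul_normal (R : realType) (u v x y z : 'rV[R]_3) :
  dot z z = 1 -> dot z u = 0 -> dot z v = 0 ->
  det3 u v z * det3 x y z = dot x u * dot y v - dot x v * dot y u.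
Proof.
move=> zz zu zv.
have -> : det3 u v z * det3 x y z =
  (dot x u * dot y v - dot x v * dot y u) * dot z z
  + (dot x v * dot y z - dot x z * dot y v) * dot z u
  - (dot x u * dot y z - dot x z * dot y u) * dot z v.
  by rewrite !det3E !dotE3; ring.
by rewrite zz zu zv !mulr0 mulr1 addr0 subr0.
Qed.

Lemma det3_normal_neq0 (R : realType) (u v z : 'rV[R]_3) :
  dot z z = 1 -> dot z u = 0 -> dot z v = 0 ->
  \rank (col_mx u v) = 2%N -> det3 u v z != 0.
Proof.
move=> zz zu zv rk; apply/eqP => /eqP/det0P[c c0 e].
have ej j : c 0 0 * u 0 j + c 0 1 * v 0 j + c 0 2%:R * z 0 j = 0.
  have := congr1 (fun A : 'rV_3 => A 0 j) e.
  rewrite !mxE !big_ord_recl big_ord0 !mxE addr0 addrA /=.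
  have -> : lift ord0 ord0 = 1 :> 'I_3 by apply: val_inj.
  by have -> : lift ord0 (lift ord0 ord0) = 2%:R :> 'I_3 by apply: val_inj.
have c2 : c 0 2%:R = 0.
  transitivity (c 0 0 * dot z u + c 0 1 * dot z v + c 0 2%:R * dot z z).
    by rewrite zz zu zv !mulr0 !add0r mulr1.
  transitivity (\sum_j z 0 j * (c 0 0 * u 0 j + c 0 1 * v 0 j + c 0 2%:R * z 0 j)).
    rewrite /dot !mulr_sumr -!big_split /=; apply: eq_bigr => j _; ring.
  by apply: big1 => j _; rewrite ej mulr0.
have rf : row_free (col_mx u v) by rewrite /row_free rk.
have e2 : row_mx (c 0 0)%:M (c 0 1)%:M *m col_mx u v = 0.
  rewrite mul_row_col !mul_scalar_mx; apply/rowP => j; rewrite !mxE.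
  by have := ej j; rewrite c2 mul0r addr0.
have := e2; rewrite -(mul0mx _ (col_mx u v)) => /(row_free_inj rf) e3.
have c00 : c 0 0 = 0.
  have := congr1 (fun A : 'M[R]_(1, 1 + 1) => lsubmx A 0 0) e3.
  by rewrite row_mxKl !mxE mulr1n.
have c01 : c 0 1 = 0.
  have := congr1 (fun A : 'M[R]_(1, 1 + 1) => rsubmx A 0 0) e3.
  by rewrite row_mxKr !mxE mulr1n.
move/negP: c0; apply; apply/eqP/rowP => j; rewrite mxE.
have [->|[->|->]] := ord3P j.
- exact: c00.
- exact: c01.
- exact: c2.
Qed.

(** With N orthogonal to U and V the hypothesis reads
    det(U,V,N) (det(U,V,N) + det(F,G,N)) = 0, and rank two makes the first
    factor nonzero. *)
Lemma curvature_of_gram (R : realType) (f n : net R) (j k : int) (N : 'rV[R]_3)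
    (F := diag12 f j k) (G := diag21 f j k)
    (U := diag12 n j k) (V := diag21 n j k) :
  dot U U * dot V V - dot U V ^+ 2 + (dot F U * dot G V - dot F V * dot G U) = 0 ->
  \rank (col_mx U V) = 2%N -> face_normal n j k N -> gauss_den f j k N != 0 ->
  gauss_curvature f n j k N = -1.
Proof.
move=> E rk [NN NU NV] den.
have d0 : det3 U V N != 0 by apply: det3_normal_neq0.
have e1 := det3_mul_normal U V NN NU NV.
have e2 := det3_mul_normal F G NN NU NV.
have {E} : det3 U V N * (det3 U V N + det3 F G N) = 0.
  rewrite mulrDr e1 e2 -E expr2; congr (_ - _ * _ + _).
  by rewrite !dotE3; ring.
move/eqP; rewrite mulf_eq0 (negbTE d0) /= addr_eq0 => /eqP e.
by rewrite /gauss_curvature -/U -/V e /gauss_den -/F -/G mulNr divff.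
Qed.

(** The edge constraints turn f_i . n_j - f_j . n_i into differences of the
    products f_i . n_i, which cancel around the quadrilateral. *)
Lemma mixed_diagonals (R : realType) (f f1 f2 f12 n n1 n2 n12 : 'rV[R]_3) :
  dot (f1 - f) (n1 + n) = 0 -> dot (f2 - f) (n2 + n) = 0 ->
  dot (f12 - f1) (n12 + n1) = 0 -> dot (f12 - f2) (n12 + n2) = 0 ->
  dot (f2 - f1) (n12 - n) = dot (f12 - f) (n2 - n1) /\
  2%:R * dot (f12 - f) (n2 - n1) =
    dot (f2 - f) (n2 - n) + dot (f12 - f1) (n12 - n1)
    - dot (f1 - f) (n1 - n) - dot (f12 - f2) (n12 - n2).
Proof.
rewrite !dotE3 !mxE => e1 e2 e3 e4.
by split; lra.
Qed.

(** * Concyclicity of four points from products of imaginary quaternions *)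

Definition cross (R : realType) (u v : 'rV[R]_3) : 'rV[R]_3 :=
  \row_j nth 0 [:: u 0 1 * v 0 2%:R - u 0 2%:R * v 0 1;
                   u 0 2%:R * v 0 0 - u 0 0 * v 0 2%:R;
                   u 0 0 * v 0 1 - u 0 1 * v 0 0] j.

Lemma cross0E (R : realType) (u v : 'rV[R]_3) :
  cross u v 0 0 = u 0 1 * v 0 2%:R - u 0 2%:R * v 0 1.
Proof. by rewrite mxE. Qed.

Lemma cross1E (R : realType) (u v : 'rV[R]_3) :
  cross u v 0 1 = u 0 2%:R * v 0 0 - u 0 0 * v 0 2%:R.
Proof. by rewrite mxE. Qed.

Lemma cross2E (R : realType) (u v : 'rV[R]_3) :
  cross u v 0 2%:R = u 0 0 * v 0 1 - u 0 1 * v 0 0.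
Proof. by rewrite mxE. Qed.

Definition crossE := (cross0E, cross1E, cross2E).

Lemma rV3P (R : realType) (u v : 'rV[R]_3) :
  u 0 0 = v 0 0 -> u 0 1 = v 0 1 -> u 0 2%:R = v 0 2%:R -> u = v.
Proof.
move=> e0 e1 e2; apply/rowP => j.
by have [->|[->|->]] := ord3P j.
Qed.

Lemma dot_eq0 (R : realType) (u : 'rV[R]_3) : dot u u = 0 -> u = 0.
Proof.
rewrite dotE3 => /eqP.
rewrite paddr_eq0 ?addr_ge0 ?sqr_ge0 -?expr2 ?sqr_ge0 //.
rewrite paddr_eq0 ?sqr_ge0 // !sqrf_eq0 => /andP[/andP[/eqP e0 /eqP e1] /eqP e2].
by apply: rV3P; rewrite mxE.
Qed.

Lemma iquat_mul (R : realType) (x y : 'rV[R]_3) :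
  iquat x *m iquat y =
  quat (- dot x y -i* cross x y 0 2%:R) (- cross x y 0 1 -i* cross x y 0 0).
Proof.
rewrite !iquatE quatM dotE3 !crossE; congr quat; apply/eqP; rewrite eq_complex /=.
  by apply/andP; split; apply/eqP; ring.
by apply/andP; split; apply/eqP; ring.
Qed.

Lemma iquat_mul_scale (R : realType) (a b c d : 'rV[R]_3) (r : R) :
  iquat a *m iquat b = r%:C *: (iquat c *m iquat d) ->
  dot a b = r * dot c d /\ cross a b = r *: cross c d.
Proof.
rewrite !iquat_mul quatZ => /quat_inj[/eqP + /eqP]; rewrite !eq_complex /=.
move=> /andP[/eqP e1 /eqP e2] /andP[/eqP e3 /eqP e4].
split; first by rewrite -[LHS]opprK e1; ring.
by apply: rV3P; rewrite [RHS]mxE -[LHS]opprK ?e2 ?e3 ?e4; ring.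
Qed.

Definition on_circle_or_line (R : realType) (a b c d : 'rV[R]_3) : Prop :=
  exists C : set 'rV[R]_3, (is_circle C \/ is_line C) /\
    [/\ C a, C b, C c & C d].

(** In the plane orthogonal to nu, the circles through 0 and t are the curves
    y.y - y.t + h nu.(y x t) = 0, where h encodes the inscribed angle over the
    chord from 0 to t.  The hypotheses say that a and c lie on the same one. *)
Lemma concyclic (R : realType) (p a t c : 'rV[R]_3) (h : R)
    (nu := cross a t) :
  nu <> 0 -> dot nu c = 0 ->
  dot a t - dot a a = h * dot nu nu ->
  dot c t - dot c c = h * dot nu (cross c t) ->
  on_circle_or_line p (p + a) (p + t) (p + c).
Proof.
move=> nu0 nuc ha hc.
(* the centre relative to p, read off the linear part of the equation *)
pose x := 2%:R^-1 *: (t - h *: cross t nu).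
have xE y : 2%:R * dot x y = dot y t - h * dot nu (cross y t).
  by rewrite !dotE3 !mxE /=; field.
have xx : 0 < dot x x.
  rewrite lt_neqAle; apply/andP; split; last first.
    by rewrite dotE3 !addr_ge0 // -expr2 sqr_ge0.
  apply/eqP => /esym/dot_eq0 x0; apply: nu0.
  have := xE a; rewrite -/nu x0 -ha.
  have -> : dot 0 a = 0 by rewrite dotE3 !mxE !mul0r !addr0.
  rewrite mulr0 subKr => /esym/dot_eq0 a0.
  by rewrite /nu a0; apply: rV3P; rewrite crossE !mxE !mul0r subrr.
pose C := [set y | dot (y - (p + x)) nu = 0 /\
  dot (y - (p + x)) (y - (p + x)) = Num.sqrt (dot x x) ^+ 2].
have on y : dot nu y = 0 -> dot y t - dot y y = h * dot nu (cross y t) -> C (p + y).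
  move=> nuy hy; rewrite /C /= sqr_sqrtr ?ltW //.
  have -> : p + y - (p + x) = y - x by rewrite opprD addrACA subrr add0r.
  split.
    have nx : 2%:R * dot x nu = 0.
      by rewrite xE /nu !dotE3 !mxE /=; ring.
    have : dot (y - x) nu = dot nu y - dot x nu by rewrite !dotE3 !mxE; ring.
    by rewrite nuy; lra.
  have : dot (y - x) (y - x) = dot y y + dot x x - 2%:R * dot x y.
    by rewrite !dotE3 !mxE; ring.
  by rewrite xE -hy; lra.
have z0 y : dot y 0 = 0 :> R by rewrite dotE3 !mxE !mulr0 !addr0.
have z1 y : dot 0 y = 0 :> R by rewrite dotE3 !mxE !mul0r !addr0.
have z2 y : cross 0 y = 0 :> 'rV[R]_3.
  by apply: rV3P; rewrite crossE !mxE !mul0r subrr.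
have z3 y : cross y y = 0 :> 'rV[R]_3 by apply: rV3P; rewrite crossE !mxE; ring.
exists C; split.
  left; exists (p + x), nu, (Num.sqrt (dot x x)); split => //.
  - exact/eqP.
  - by rewrite sqrtr_gt0.
split.
- by rewrite -[p]addr0; apply: on; rewrite ?z2 ?z0 ?z1 ?mulr0 ?subrr.
- by apply: on => //; rewrite /nu !dotE3 !mxE /=; ring.
- apply: on; last by rewrite z3 z0 mulr0 subrr.
  by rewrite /nu !dotE3 !mxE /=; ring.
- exact: on.
Qed.

Lemma three_points (R : realType) (p a t : 'rV[R]_3) :
  exists C : set 'rV[R]_3, (is_circle C \/ is_line C) /\
    [/\ C p, C (p + a) & C (p + t)].
Proof.
have [nu0|/eqP nu0] := eqVneq (cross a t) 0.
  have lineP (v : 'rV[R]_3) (x y : R) : v != 0 -> a = x *: v -> t = y *: v ->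
    exists C : set 'rV[R]_3, (is_circle C \/ is_line C) /\
    [/\ C p, C (p + a) & C (p + t)].
    move=> v0 -> ->; exists [set p + a *: v | a in [set: R]]; split.
      by right; exists p, v.
    split; [exists 0|exists x|exists y] => //; by rewrite scale0r addr0.
  have [a0|a0] := eqVneq a 0.
    have [t0|t0] := eqVneq t 0.
      apply: (lineP (const_mx 1) 0 0); rewrite ?a0 ?t0 ?scale0r //.
      apply/eqP => /rowP/(_ 0); rewrite !mxE => /eqP; by rewrite oner_eq0.
    by apply: (lineP t 0 1) => //; rewrite ?a0 ?scale0r ?scale1r.
  have aa : dot a a != 0 by apply: contra a0 => /eqP/dot_eq0 ->.
  apply: (lineP a 1 (dot a t / dot a a)) => //; first by rewrite scale1r.
  (* Lagrange: a x (a x t) = (a . t) a - (a . a) t *)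
  have e : dot a a *: t = dot a t *: a.
    have : cross a (cross a t) = dot a t *: a - dot a a *: t.
      by apply: rV3P; rewrite crossE [RHS]mxE !dotE3 !mxE /=; ring.
    have -> : cross a (cross a t) = 0.
      by rewrite nu0; apply: rV3P; rewrite crossE !mxE !mulr0 subrr.
    by move/esym/eqP; rewrite subr_eq0 => /eqP.
  by rewrite mulrC -scalerA -e scalerA mulVf // scale1r.
have nn : dot (cross a t) (cross a t) != 0.
  by apply/eqP => /dot_eq0.
have ha : dot a t - dot a a = (dot a t - dot a a) / dot (cross a t) (cross a t) *
   dot (cross a t) (cross a t) by rewrite divfK.
have nua : dot (cross a t) a = 0 by rewrite !dotE3 !mxE /=; ring.
have [C [hC [Cp Ca Ct _]]] := concyclic p nu0 nua ha ha.
by exists C.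
Qed.

Lemma dot_cross_eq0 (R : realType) (a b : 'rV[R]_3) :
  dot a b = 0 -> cross a b = 0 -> a = 0 \/ b = 0.
Proof.
move=> d c; have : dot a a * dot b b = 0.
  transitivity (dot a b ^+ 2 + dot (cross a b) (cross a b)).
    by rewrite !dotE3 !mxE /=; ring.
  by rewrite c d [dot 0 0]dotE3 !mxE expr2 !mul0r !addr0.
by move/eqP; rewrite mulf_eq0 => /orP[] /eqP/dot_eq0; [left|right].
Qed.

(** By comparison of scalar and vector parts, a . b and a x b are proportional to
    c . d and c x d.  Unless they degenerate, the triangles over the chord from p
    to p + a + b with apex p + a and p + c thus lie in one plane and have the same
    oriented cotangent at the apex: the inscribed angle condition of [concyclic]. *)
Lemma on_circle_or_line_of_product (R : realType) (p a b c d : 'rV[R]_3) (r : R) :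
  a + b = c + d ->
  iquat a *m iquat b = r%:C *: (iquat c *m iquat d) ->
  on_circle_or_line p (p + a) (p + a + b) (p + c).
Proof.
move=> abcd /iquat_mul_scale[dab cab].
have tri : a = 0 \/ b = 0 \/ a + b = 0 \/ c = 0 ->
    on_circle_or_line p (p + a) (p + a + b) (p + c).
  rewrite -addrA; case=> [->|[->|[->|->]]]; rewrite ?addr0 ?add0r.
  - by have [C [hC []]] := three_points p b c; exists C.
  - by have [C [hC []]] := three_points p a c; exists C.
  - by have [C [hC []]] := three_points p a c; exists C.
  - by have [C [hC []]] := three_points p a (a + b); exists C.
have [r0|r0] := eqVneq r 0.
  move: dab cab; rewrite r0 mul0r scale0r => dab cab.
  by apply: tri; have [->|->] := dot_cross_eq0 dab cab; [left|right; left].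
have catE x y : cross x (x + y) = cross x y :> 'rV[R]_3.
  by apply: rV3P; rewrite !mxE /=; ring.
have [nu0|/eqP nu0] := eqVneq (cross a b) 0.
  have [t0|t0] := eqVneq (a + b) 0; first by apply: tri; right; right; left.
  have cd0 : cross c d = 0.
    by apply: (scalerI r0); rewrite -cab nu0 scaler0.
  have par x : cross x (a + b) = 0 -> exists y, x = y *: (a + b).
    move=> xt; exists (dot (a + b) x / dot (a + b) (a + b)).
    have tt : dot (a + b) (a + b) != 0 by apply: contra t0 => /eqP/dot_eq0 ->.
    move: (a + b) xt tt => t xt tt.
    have e : dot t t *: x = dot t x *: t.
      apply/eqP; rewrite -subr_eq0; apply/eqP.
      transitivity (cross t (cross x t)).
        by apply: rV3P; rewrite crossE [LHS]mxE !dotE3 !mxE /=; ring.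
      by rewrite xt; apply: rV3P; rewrite crossE !mxE !mulr0 subrr.
    by rewrite mulrC -scalerA -e scalerA mulVf // scale1r.
  have [x ax] : exists y, a = y *: (a + b) by apply: par; rewrite catE.
  have [y cy] : exists y, c = y *: (a + b) by apply: par; rewrite abcd catE.
  exists [set p + z *: (a + b) | z in [set: R]]; split.
    by right; exists p, (a + b).
  split.
  - by exists 0 => //; rewrite scale0r addr0.
  - by exists x => //; rewrite -ax.
  - by exists 1 => //; rewrite scale1r addrA.
  - by exists y => //; rewrite -cy.
rewrite -addrA.
have nu0' : cross a (a + b) <> 0 by rewrite catE.
have cT : cross a (a + b) = r *: cross c (a + b) by rewrite catE cab abcd catE.
have cT' : cross c (a + b) = r^-1 *: cross a (a + b).
  by rewrite cT scalerA mulVf // scale1r.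
have nn : dot (cross a (a + b)) (cross a (a + b)) != 0.
  by apply/eqP => /dot_eq0.
apply: (@concyclic _ p a (a + b) c ((dot a (a + b) - dot a a) /
   dot (cross a (a + b)) (cross a (a + b)))) => //.
- rewrite cT; transitivity (r * dot (cross c (a + b)) c).
    by rewrite !dotE3 !mxE; ring.
  by rewrite !dotE3 !mxE /=; ring.
- by rewrite divfK.
- rewrite cT'.
  have -> x : dot (cross a (a + b)) (r^-1 *: x) = r^-1 * dot (cross a (a + b)) x.
    by rewrite !dotE3 !mxE; ring.
  rewrite mulrCA divfK //.
  have -> : dot a (a + b) - dot a a = dot a b by rewrite !dotE3 !mxE; ring.
  have -> : dot c (a + b) - dot c c = dot c d by rewrite abcd !dotE3 !mxE; ring.
  by rewrite dab mulKf.
Qed.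

(** * Normal form of the Lax matrices *)

Lemma cexpD (R : realType) (z : R[i]) : cexp (z + z) = cexp z ^+ 2.
Proof.
case: z => x y; rewrite /cexp /cis /= expRD sinD cosD; apply/eqP.
rewrite eq_complex /=; apply/andP; split; apply/eqP; ring.
Qed.

Lemma csin_double (R : realType) (z : R[i]) :
  csin z = 2%:R * csin (z / 2%:R) * ccos (z / 2%:R).
Proof.
have i0 : 'i%C != 0 :> R[i] by rewrite eq_complex /= oner_eq0 andbF.
rewrite /csin /ccos.
have -> : 'i%C * z = 'i%C * (z / 2%:R) + 'i%C * (z / 2%:R) by field.
by rewrite opprD !cexpD; field.
Qed.

(** If one half-angle factor vanished, so would sin delta by the double angle
    formula, contradicting sin delta > 1. *)
Lemma lax_parameter_neq0 (R : realType) (delta : R[i]) :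
  lax_parameter delta ->
  csin (delta / 2%:R) != 0 /\ ccos (delta / 2%:R) != 0.
Proof.
case=> [[_ c0]|[_]].
  by rewrite /ctan mulf_eq0 negb_or => /andP[].
move=> gt1; apply/andP; rewrite -negb_or -mulf_eq0; apply/eqP => sc0.
move: gt1; rewrite csin_double -mulrA sc0 mulr0 /=.
by rewrite ltr10.
Qed.

Definition edge_trace (R : realType) (delta : R[i]) : R[i] :=
  ctan (delta / 2%:R) ^+ 2 + ccot (delta / 2%:R) ^+ 2.

Definition edge_quat (R : realType) (a sigma la : R[i]) : 'M[R[i]]_2 :=
  quat a ('i%C * (la - sigma / la)).

(** In a quaternion the second diagonal entry is conjugate to the first, so
    |a|^2 is the product of the two entries, from which z cancels. *)
Lemma lax_matrix_edge_quat (R : realType) (delta z s s' : R[i]) :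
  lax_parameter delta -> z != 0 -> `|s| = 1 -> `|s'| = 1 ->
  (forall lambda, 0 < lambda -> quaternion (lax_matrix delta z s s' lambda)) ->
  exists a, a * a^*%C = edge_trace delta + s * s' + (s * s')^-1 /\
    forall lambda, lax_matrix delta z s s' lambda = edge_quat a (s * s') lambda%:C.
Proof.
move=> /lax_parameter_neq0[sn0 cs0] z0 hs hs' hq.
have unitc (x : R[i]) : `|x| = 1 -> x != 0 /\ x^*%C = x^-1.
  move=> hx; have x0 : x != 0 by rewrite -normr_eq0 hx oner_eq0.
  by split=> //; rewrite invc_norm hx expr1n invr1 mul1r.
have [s0 sc] := unitc _ hs; have [s'0 s'c] := unitc _ hs'.
set a := ccot (delta / 2%:R) * (z / s) + ctan (delta / 2%:R) * (z * s').
set b := ccot (delta / 2%:R) * (s / z) + ctan (delta / 2%:R) * (1 / (z * s')).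
have ab : b = a^*%C.
  have [w [v]] := quaternionP (hq 1 ltr01); rewrite /lax_matrix -/a -/b.
  by move=> e; have [-> _ _] := mx2_inj e.
exists a; split.
  rewrite -ab /a /b /edge_trace /ccot /ctan; field.
  by rewrite ?s0 ?s'0 ?z0 ?sn0 ?cs0.
move=> la; rewrite /lax_matrix -/a -/b /edge_quat /quat -ab; congr mx2.
rewrite !conjcE sc s'c mulNr opprK; congr (_ * _).
have [->|l0] := eqVneq la%:C 0; first by rewrite !mul0r invr0 !mulr0.
by field; rewrite ?s0 ?s'0 ?l0.
Qed.

(** * Derivatives of the frame *)

Definition mx_is_derive (R : realType) (F : R -> 'M[R[i]]_2) (t : R)
    (D : 'M[R[i]]_2) : Prop :=
  forall i j : 'I_2,
    is_derive t 1 (fun u => complex.Re (F u i j)) (complex.Re (D i j)) /\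
    is_derive t 1 (fun u => complex.Im (F u i j)) (complex.Im (D i j)).

Lemma mx_derive_val (R : realType) (F : R -> 'M[R[i]]_2) (t : R)
    (D : 'M[R[i]]_2) :
  mx_is_derive F t D -> mx_derive F t = D.
Proof.
move=> h; apply/matrixP => i j; rewrite mxE !derive1E.
have [h1 h2] := h i j.
by rewrite (@derive_val _ _ _ _ _ _ _ h1) (@derive_val _ _ _ _ _ _ _ h2); case: (D i j).
Qed.

Lemma mx_is_deriveM (R : realType) (F G : R -> 'M[R[i]]_2) (t : R)
    (dF dG : 'M[R[i]]_2) :
  mx_is_derive F t dF -> mx_is_derive G t dG ->
  mx_is_derive (fun u => F u *m G u) t (dF *m G t + F t *m dG).
Proof.
move=> hF hG i j.
have mulE (A B : 'M[R[i]]_2) : (A *m B) i j = A i 0 * B 0 j + A i 1 * B 1 j.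
  rewrite mxE !big_ord_recl big_ord0 addr0.
  by have -> : lift ord0 ord0 = 1 :> 'I_2 by apply: val_inj.
have ReM (x y : R[i]) : complex.Re (x * y) =
    complex.Re x * complex.Re y - complex.Im x * complex.Im y by case: x; case: y.
have ImM (x y : R[i]) : complex.Im (x * y) =
    complex.Re x * complex.Im y + complex.Im x * complex.Re y by case: x; case: y.
have ReD (x y : R[i]) : complex.Re (x + y) = complex.Re x + complex.Re y.
  by case: x; case: y.
have ImD (x y : R[i]) : complex.Im (x + y) = complex.Im x + complex.Im y.
  by case: x; case: y.
have [a1 a2] := hF i 0; have [a3 a4] := hF i 1.
have [b1 b2] := hG 0 j; have [b3 b4] := hG 1 j.
split.
- have -> : (fun u => complex.Re ((F u *m G u) i j)) =
   (fun u => complex.Re (F u i 0)) * (fun u => complex.Re (G u 0 j))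
   - (fun u => complex.Im (F u i 0)) * (fun u => complex.Im (G u 0 j))
   + ((fun u => complex.Re (F u i 1)) * (fun u => complex.Re (G u 1 j))
   - (fun u => complex.Im (F u i 1)) * (fun u => complex.Im (G u 1 j))).
    by apply/funext => u; rewrite mulE ReD !ReM.
  apply: (is_derive_eq (is_deriveD
    (is_deriveB (is_deriveM a1 b1) (is_deriveM a2 b2))
    (is_deriveB (is_deriveM a3 b3) (is_deriveM a4 b4)))).
  rewrite mxE ReD !mulE !ReD !ReM /GRing.scale /=; ring.
- have -> : (fun u => complex.Im ((F u *m G u) i j)) =
   (fun u => complex.Re (F u i 0)) * (fun u => complex.Im (G u 0 j))
   + (fun u => complex.Im (F u i 0)) * (fun u => complex.Re (G u 0 j))
   + ((fun u => complex.Re (F u i 1)) * (fun u => complex.Im (G u 1 j))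
   + (fun u => complex.Im (F u i 1)) * (fun u => complex.Re (G u 1 j))).
    by apply/funext => u; rewrite mulE ImD !ImM.
  apply: (is_derive_eq (is_deriveD
    (is_deriveD (is_deriveM a1 b2) (is_deriveM a2 b1))
    (is_deriveD (is_deriveM a3 b4) (is_deriveM a4 b3)))).
  rewrite mxE ImD !mulE !ImD !ImM /GRing.scale /=; ring.
Qed.

Lemma mx_smooth_is_derive_exp (R : realType) (F : R -> 'M[R[i]]_2) (t : R) :
  mx_smooth_pos F ->
  mx_is_derive (fun u => F (expR u)) t (mx_derive (fun u => F (expR u)) t).
Proof.
move=> sF i j; have [/derivableP h1 /derivableP h2] := sF i j 0%N _ (expR_gt0 t).
have comp (g : R -> R) (d : R) : is_derive (expR t) 1 g d ->
    is_derive t 1 (g \o expR) (derive1 (g \o expR) t).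
  by move=> hg; rewrite derive1E; apply/derivableP;
    exact: (@ex_derive _ _ _ _ _ _ _ (is_derive1_comp hg (is_derive_expR t))).
by rewrite mxE /=; split; [exact: comp h1|exact: comp h2].
Qed.

Lemma edge_quat_is_derive (R : realType) (a sigma : R[i]) (t : R) :
  mx_is_derive (fun u => edge_quat a sigma (expR u)%:C) t
    (quat 0 ('i%C * ((expR t)%:C + sigma / (expR t)%:C))).
Proof.
have vE (u : R) : 'i%C * ((expR u)%:C - sigma / (expR u)%:C) =
   complex.Im sigma * expR (- u) +i* (expR u - complex.Re sigma * expR (- u)).
  case: sigma => x y; rewrite -fmorphV -expRN /=.
  by apply/eqP; rewrite eq_complex /=; apply/andP; split; apply/eqP; ring.
have dvE : 'i%C * ((expR t)%:C + sigma / (expR t)%:C) =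
   - (complex.Im sigma * expR (- t))
     +i* (expR t + complex.Re sigma * expR (- t)).
  case: sigma {vE} => x y; rewrite -fmorphV -expRN /=.
  by apply/eqP; rewrite eq_complex /=; apply/andP; split; apply/eqP; ring.
have dN : is_derive t 1 (fun u : R => expR (- u)) (- expR (- t)).
  have := is_derive1_comp (is_derive_expR (- t)) (is_deriveNid t 1).
  by rewrite mulrN mulr1.
have dP := is_derive_expR t.
have d1 : is_derive t 1 (fun u => complex.Im sigma * expR (- u))
    (- (complex.Im sigma * expR (- t))).
  by apply: is_derive_eq; rewrite /GRing.scale /= mulrN.
have d2 : is_derive t 1 (fun u => expR u - complex.Re sigma * expR (- u))
    (expR t + complex.Re sigma * expR (- t)).
  by apply: is_derive_eq; rewrite /GRing.scale /= mulrN opprK.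
have ext (f g : R -> R) (d : R) : f =1 g -> is_derive t 1 f d -> is_derive t 1 g d.
  by move=> /funext ->.
have cst0 (c : R) : is_derive t 1 (fun _ : R => c) 0 by exact: is_derive_cst.
have d2' : is_derive t 1 (fun u => expR u - complex.Re sigma * expR (- u))
    (- - (expR t + complex.Re sigma * expR (- t))) by rewrite opprK.
rewrite dvE => i j; rewrite !mxE /=.
case ei: (i == 0); case ej: (j == 0) => /=; split.
- by apply: (ext (fun _ => complex.Re a)) => // u; rewrite /edge_quat mxE ei ej.
- by apply: (ext (fun _ => complex.Im a)) => // u; rewrite /edge_quat mxE ei ej.
- by apply: (ext _ _ _ _ d1) => u; rewrite /edge_quat vE mxE ei ej.
- by apply: (ext _ _ _ _ d2) => u; rewrite /edge_quat vE mxE ei ej.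
- by apply: (ext _ _ _ _ (is_deriveN d1)) => u; rewrite /edge_quat vE mxE ei ej.
- by apply: (ext _ _ _ _ d2') => u; rewrite /edge_quat vE mxE ei ej /= opprK.
- by apply: (ext (fun _ => complex.Re a)) => // u; rewrite /edge_quat mxE ei ej; case: a.
- rewrite oppr0; apply: (ext (fun _ => - complex.Im a)) => // u.
  by rewrite /edge_quat mxE ei ej; case: a.
Qed.

(** * Transports along edges and diagonals *)

Lemma transport_differences (R : realType) (P Pp dP dPp : 'M[R[i]]_2)
    (w v dw dv r dr D : R[i]) (x xp y yp : 'rV[R]_3)
    (DE : D = w * w^*%C + v * v^*%C)
    (r0 : r != 0) (UP : P \in unitmx) (UX : quat w v \in unitmx)
    (eP : r *: Pp = quat w v *m P)
    (edP : dr *: Pp + r *: dPp = quat dw dv *m P + quat w v *m dP)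
    (hx : iquat x = frame_position P dP) (hxp : iquat xp = frame_position Pp dPp)
    (hy : iquat y = frame_normal P) (hyp : iquat yp = frame_normal Pp) :
  (dot (yp - y) (yp - y))%:C = 4%:R * (v * v^*%C) / D /\
  (dot (xp - x) (yp - y))%:C = 2%:R * 'i%C * (v^*%C * dv - v * dv^*%C) / D.
Proof.
have D0 : D != 0 by rewrite DE; exact: quat_unit_norm UX.
have [UPp _] := invmx_transport r0 UP UX eP.
have [yyp xy xyp] := transport_dots r0 UP UX eP edP hx hxp hy hyp.
have -> : dot (yp - y) (yp - y) = dot y y + dot yp yp - 2%:R * dot y yp.
  by rewrite !dotE3 !mxE; ring.
have -> : dot (xp - x) (yp - y) = dot (xp - x) yp - dot (xp - x) y.
  by rewrite !dotE3 !mxE; ring.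
rewrite (frame_normal_unit UP hy) (frame_normal_unit UPp hyp).
rewrite !(rmorphB, rmorphD, rmorphM, rmorph1, rmorph_nat) /= yyp xy xyp.
by rewrite -!DE; split; field.
Qed.

(** The contributions of sigma to |a|^2 and to the off-diagonal entry cancel;
    hence opposite edges carry the same norm. *)
Lemma edge_norm (R : realType) (a sigma k la : R[i]) :
  la^*%C = la -> la != 0 -> sigma^*%C = sigma^-1 -> sigma != 0 ->
  a * a^*%C = k + sigma + sigma^-1 ->
  a * a^*%C + 'i%C * (la - sigma / la) * ('i%C * (la - sigma / la))^*%C =
  k + (la ^+ 2 + la ^- 2).
Proof.
move=> laR la0 sigmaJ sigma0 aa; rewrite aa !conjcE laR sigmaJ; apply/subr0_eq.
transitivity (- ('i%C * 'i%C + 1) * (la - sigma / la) * (la - sigma^-1 / la)).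
  by field; rewrite ?la0 ?sigma0.
by rewrite mulcii addNr oppr0 !mul0r.
Qed.

Lemma edge_transport (R : realType) (P Pp dP dPp : 'M[R[i]]_2)
    (a sigma k la : R[i]) (x xp y yp : 'rV[R]_3)
    (laR : la^*%C = la) (la0 : la != 0)
    (sigmaJ : sigma^*%C = sigma^-1) (sigma0 : sigma != 0)
    (aa : a * a^*%C = k + sigma + sigma^-1)
    (UP : P \in unitmx) (UX : edge_quat a sigma la \in unitmx)
    (eP : Pp = edge_quat a sigma la *m P)
    (edP : dPp = quat 0 ('i%C * (la + sigma / la)) *m P + edge_quat a sigma la *m dP)
    (hx : iquat x = frame_position P dP) (hxp : iquat xp = frame_position Pp dPp)
    (hy : iquat y = frame_normal P) (hyp : iquat yp = frame_normal Pp)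
    (D := k + (la ^+ 2 + la ^- 2)) :
  [/\ dot (xp - x) (yp + y) = 0, D != 0,
    (dot y yp)%:C = 1 - 2%:R * (la ^+ 2 + la ^- 2 - sigma - sigma^-1) / D &
    (dot (xp - x) (yp - y))%:C = 4%:R * 'i%C * (sigma - sigma^-1) / D].
Proof.
have r0 : (1 : R[i]) != 0 by exact: oner_neq0.
have eP' : 1 *: Pp = edge_quat a sigma la *m P by rewrite scale1r.
have edP' : 0 *: Pp + 1 *: dPp =
   quat 0 ('i%C * (la + sigma / la)) *m P + edge_quat a sigma la *m dP.
  by rewrite scale1r scale0r add0r.
have i2 := mulcii R.
have DE := edge_norm laR la0 sigmaJ sigma0 aa; rewrite -/D in DE.
have D0 : D != 0 by rewrite -DE; exact: quat_unit_norm UX.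
have [yyp xy xyp] := transport_dots r0 UP UX eP' edP' hx hxp hy hyp.
rewrite DE in yyp xy xyp.
split=> //.
- apply: (@complexI R).
  have -> : dot (xp - x) (yp + y) = dot (xp - x) yp + dot (xp - x) y.
    by rewrite !dotE3 !mxE; ring.
  by rewrite rmorphD /= xyp xy; move: (D^-1) => Di; rewrite !conjcE; ring.
- rewrite yyp !conjcE laR sigmaJ; apply/subr0_eq.
  transitivity (2%:R * ('i%C * 'i%C + 1) * (la - sigma / la) * (la - sigma^-1 / la) / D).
    by field; rewrite ?la0 ?sigma0 ?D0.
  by rewrite i2 addNr !(mulr0, mul0r).
- have -> : dot (xp - x) (yp - y) = dot (xp - x) yp - dot (xp - x) y.
    by rewrite !dotE3 !mxE; ring.
  rewrite rmorphB /= xyp xy !conjcE laR sigmaJ; apply/subr0_eq.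
  transitivity (- 4%:R * 'i%C * ('i%C * 'i%C + 1) * (sigma - sigma^-1) / D).
    by field; rewrite ?la0 ?sigma0 ?D0.
  by rewrite i2 addNr !(mulr0, mul0r).
Qed.

(** Differentiation in t changes the sign of the second coefficient of v, so that
    the product of the increments of f and n only retains the imaginary part of q p^*. *)
Lemma diagonal_transport (R : realType) (P Pp dP dPp : 'M[R[i]]_2)
    (w v dw dv r dr p q la D : R[i]) (x xp y yp : 'rV[R]_3)
    (laR : la^*%C = la) (la0 : la != 0)
    (DE : D = w * w^*%C + v * v^*%C)
    (vE : v = 'i%C * (la * p - q / la)) (dvE : dv = 'i%C * (la * p + q / la))
    (r0 : r != 0) (UP : P \in unitmx) (UX : quat w v \in unitmx)
    (eP : r *: Pp = quat w v *m P)
    (edP : dr *: Pp + r *: dPp = quat dw dv *m P + quat w v *m dP)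
    (hx : iquat x = frame_position P dP) (hxp : iquat xp = frame_position Pp dPp)
    (hy : iquat y = frame_normal P) (hyp : iquat yp = frame_normal Pp) :
  (dot (yp - y) (yp - y))%:C =
    4%:R * ((la * p - q / la) * (la * p^*%C - q^*%C / la)) / D /\
  (dot (xp - x) (yp - y))%:C = 4%:R * 'i%C * (q * p^*%C - p * q^*%C) / D.
Proof.
have [-> ->] := transport_differences DE r0 UP UX eP edP hx hxp hy hyp.
have D0 : D != 0 by rewrite DE; exact: quat_unit_norm UX.
have i2 := mulcii R.
rewrite vE dvE !conjcE laR; split; apply/subr0_eq.
- transitivity (- 4%:R * ('i%C * 'i%C + 1) *
    ((la * p - q / la) * (la * p^*%C - q^*%C / la)) / D).
    by field; rewrite ?la0 ?D0.
  by rewrite i2 addNr !(mulr0, mul0r).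
- transitivity (- 4%:R * 'i%C * ('i%C * 'i%C + 1) *
    (q * p^*%C - p * q^*%C) / D).
    by field; rewrite ?la0 ?D0.
  by rewrite i2 addNr !(mulr0, mul0r).
Qed.

(** Compatibility compares the two paths between one pair of opposite corners of a
    quadrilateral; this is the comparison for the other pair, where a step back
    along L is Ls up to the factor D. *)
Lemma compat_adjoint (K : fieldType) (L Ls L2 L2s M M1 : 'M[K]_2) (D : K) :
  D != 0 -> M1 *m L = L2 *m M -> L *m Ls = D%:M -> L2s *m L2 = D%:M ->
  L2s *m M1 = M *m Ls.
Proof.
move=> D0 e eL eL2; apply: (scalerI D0).
transitivity (L2s *m (M1 *m L) *m Ls).
  by rewrite -mul_mx_scalar -eL !mulmxA.
by rewrite e !mulmxA eL2 -mulmxA mul_scalar_mx.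
Qed.

Lemma quat_normM (R : realType) (w v w' v' : R[i]) :
  (w * w' - v * v'^*%C) * (w * w' - v * v'^*%C)^*%C
  + (w * v' + v * w'^*%C) * (w * v' + v * w'^*%C)^*%C =
  (w * w^*%C + v * v^*%C) * (w' * w'^*%C + v' * v'^*%C).
Proof. by rewrite !conjcE; ring. Qed.

(** * Relations on a quadrilateral *)

(** The off-diagonal entries have two coefficients, of la and of 1/la, which the
    values at la = 1 and la = 2 separate.  The last relation is the first diagonal
    entry of the compatibility between the frames P1 and P2. *)
Lemma face_relations (R : realType) (s s1 s2 s12 a al a2 al1 k1 : R[i])
    (s0 : s != 0) (s10 : s1 != 0) (s20 : s2 != 0) (s120 : s12 != 0)
    (sJ : s^*%C = s^-1) (s1J : s1^*%C = s1^-1)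
    (s2J : s2^*%C = s2^-1) (s12J : s12^*%C = s12^-1)
    (aa : a * a^*%C = k1 + s * s1 + (s * s1)^-1)
    (a2a2 : a2 * a2^*%C = k1 + s2 * s12 + (s2 * s12)^-1)
    (U : edge_quat a (s * s1) 1 \in unitmx)
    (compat : forall lambda : R, 0 < lambda ->
      edge_quat al1 (s1 * s12) lambda%:C *m edge_quat a (s * s1) lambda%:C =
      edge_quat a2 (s2 * s12) lambda%:C *m edge_quat al (s * s2) lambda%:C) :
  [/\ al1 + a^*%C = a2 + al^*%C,
      al1 * (s * s1) + a^*%C * (s1 * s12) = a2 * (s * s2) + al^*%C * (s2 * s12) &
      al * a^*%C - a2^*%C * al1 =
        s * s2 + (s * s1)^-1 - s2 * s12 - (s1 * s12)^-1].
Proof.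
have i0 : 'i%C != 0 :> R[i] by rewrite eq_complex /= oner_eq0 andbF.
have i2 := mulcii R.
have two0 : 0 < 2%:R :> R by rewrite ltr0n.
have c1 := compat 1 ltr01; have c2 := compat 2%:R two0.
move: c1; rewrite rmorph1 => c1; move: c2; rewrite rmorph_nat => c2.
have [_ v1] := quat_inj (etrans (esym (quatM _ _ _ _)) (etrans c1 (quatM _ _ _ _))).
have [_ v2] := quat_inj (etrans (esym (quatM _ _ _ _)) (etrans c2 (quatM _ _ _ _))).
(* an entry i (la p - q / la) is i (p - q) at la = 1 and i (2 p - q / 2) at la = 2 *)
have E1 : al1 + a^*%C = a2 + al^*%C.
  apply/subr0_eq.
  match type of v1 with ?l1 = ?r1 => match type of v2 with ?l2 = ?r2 =>
    transitivity ((3%:R * 'i%C)^-1 * (2%:R * (l2 - r2) - (l1 - r1)))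
  end end; first by field.
  by rewrite v1 v2 !subrr mulr0 subrr mulr0.
have E2 : al1 * (s * s1) + a^*%C * (s1 * s12) = a2 * (s * s2) + al^*%C * (s2 * s12).
  apply/subr0_eq.
  match type of v1 with ?l1 = ?r1 => match type of v2 with ?l2 = ?r2 =>
    transitivity ((3%:R * 'i%C)^-1 * (2%:R * (l2 - r2) - 4%:R * (l1 - r1)))
  end end; first by field.
  by rewrite v1 v2 !subrr !mulr0 subrr mulr0.
split=> //.
have D1 := edge_norm (conjc1 R) (oner_neq0 _) (conjc_invM sJ s1J) (mulf_neq0 s0 s10) aa.
have D2 := edge_norm (conjc1 R) (oner_neq0 _) (conjc_invM s2J s12J)
   (mulf_neq0 s20 s120) a2a2.
have D0 := quat_unit_norm U; rewrite D1 in D0.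
have st := compat_adjoint D0 c1 (etrans (quat_starr _ _) (congr1 (fun x => x%:M) D1))
   (etrans (quat_starl _ _) (congr1 (fun x => x%:M) D2)).
have [w1 _] := quat_inj (etrans (esym (quatM _ _ _ _)) (etrans st (quatM _ _ _ _))).
apply/subr0_eq; move: w1; rewrite !conjcE ?sJ ?s1J ?s2J ?s12J => w1.
match type of w1 with ?l1 = ?r1 =>
    transitivity (- (l1 - r1) + ('i%C * 'i%C + 1) *
    (s2 * s12 + (s1 * s12)^-1 - s * s2 - (s * s1)^-1))
end.
  by field; rewrite ?s0 ?s10 ?s20 ?s120.
by rewrite w1 subrr i2 addNr mul0r oppr0 addr0.
Qed.

Lemma quat_star_unit (R : realType) (w v : R[i]) :
  quat w v \in unitmx -> quat w^*%C (- v) \in unitmx.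
Proof.
move=> U; have D0 := quat_unit_norm U.
have -> : quat w^*%C (- v) = (w * w^*%C + v * v^*%C) *: invmx (quat w v).
  by rewrite invmx_quat // scalerA divff // scale1r.
by rewrite unitmxZ ?unitfE // unitmx_inv.
Qed.

Lemma quat_star_norm (R : realType) (w v : R[i]) :
  w^*%C * w^*%C^*%C + - v * (- v)^*%C = w * w^*%C + v * v^*%C.
Proof. by rewrite !conjcE; ring. Qed.

Lemma quat_star_derivation (R : realType) (w v dv : R[i]) :
  quat 0 (- dv) *m quat w v + quat w^*%C (- v) *m quat 0 dv =
  (v * dv^*%C + dv * v^*%C)%:M.
Proof. by rewrite !quatM quatD mx2_scalar /quat !conjcE; congr mx2; ring. Qed.

(** The transport from P1 to P2 through P involves the inverse of L, that is Ls
    up to the factor D; keeping D on the left avoids differentiating a quotient. *)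
Lemma opposite_step (K : fieldType) (L Ls dL dLs M dM P dP P1 dP1 P2 dP2 : 'M[K]_2)
    (D dr : K) :
  Ls *m L = D%:M -> dLs *m L + Ls *m dL = dr%:M ->
  P1 = L *m P -> dP1 = dL *m P + L *m dP ->
  P2 = M *m P -> dP2 = dM *m P + M *m dP ->
  D *: P2 = (M *m Ls) *m P1 /\
  dr *: P2 + D *: dP2 = (dM *m Ls + M *m dLs) *m P1 + (M *m Ls) *m dP1.
Proof.
move=> LL dLL -> -> -> ->; split.
  by rewrite -mulmxA (mulmxA Ls) LL mul_scalar_mx -scalemxAr.
have -> : dr *: (M *m P) = M *m (dLs *m L + Ls *m dL) *m P.
  by rewrite dLL mul_mx_scalar scalemxAl.
have -> : D *: (dM *m P + M *m dP) = dM *m (Ls *m L) *m P + M *m (Ls *m L) *m dP.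
  by rewrite LL !mul_mx_scalar scalerDr !scalemxAl.
rewrite !(mulmxDl, mulmxDr) !mulmxA; set t1 := M *m dLs *m L *m P.
set t2 := M *m Ls *m dL *m P; set t3 := dM *m Ls *m L *m P.
by rewrite addrACA addrA [t1 + t3]addrC addrA.
Qed.

(** The terms uv and fv enter through (uv + i fv)(uv - i fv) = uv^2 + fv^2. *)
Lemma gram_of_products (F : fieldType) (i D X Y A B Hp Hm uu vv uv fu gv fv : F) :
  D != 0 -> i * i = -1 ->
  uu = 4%:R * X / D -> vv = 4%:R * Y / D ->
  fu = 4%:R * i * A / D -> gv = 4%:R * i * B / D ->
  uv + i * fv = 4%:R * Hp / D -> uv - i * fv = 4%:R * Hm / D ->
  X * Y - A * B = Hp * Hm ->
  uu * vv - uv * uv + (fu * gv - fv * fv) = 0.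
Proof.
move=> D0 i2 -> -> -> -> hp hm E.
transitivity (16%:R * (X * Y - A * B) / D ^+ 2 - (uv + i * fv) * (uv - i * fv)
  + (i * i + 1) * (16%:R * A * B / D ^+ 2 - fv ^+ 2)); first by field.
by rewrite hp hm E i2; field.
Qed.

Definition moving_frame (R : realType) (P dP : 'M[R[i]]_2) (x y : 'rV[R]_3) : Prop :=
  [/\ P \in unitmx, iquat x = frame_position P dP & iquat y = frame_normal P].

Definition lax_step (R : realType) (a sigma la : R[i])
    (P dP Pp dPp : 'M[R[i]]_2) : Prop :=
  [/\ edge_quat a sigma la \in unitmx,
      Pp = edge_quat a sigma la *m P &
      dPp = quat 0 ('i%C * (la + sigma / la)) *m P + edge_quat a sigma la *m dP].

(** The products F.U, U.U come from the transport M1 L, the products G.V, V.V from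
    M L^*, and the mixed ones from the four edges. *)
Lemma face_gram_identity (R : realType) (s s1 s2 s12 a al a2 al1 k1 k2 la : R[i])
    (P dP P1 dP1 P2 dP2 P12 dP12 : 'M[R[i]]_2)
    (f f1 f2 f12 n n1 n2 n12 : 'rV[R]_3)
    (laR : la^*%C = la) (la0 : la != 0)
    (s0 : s != 0) (s10 : s1 != 0) (s20 : s2 != 0) (s120 : s12 != 0)
    (sJ : s^*%C = s^-1) (s1J : s1^*%C = s1^-1)
    (s2J : s2^*%C = s2^-1) (s12J : s12^*%C = s12^-1)
    (aa : a * a^*%C = k1 + s * s1 + (s * s1)^-1)
    (alal : al * al^*%C = k2 + s * s2 + (s * s2)^-1)
    (a2a2 : a2 * a2^*%C = k1 + s2 * s12 + (s2 * s12)^-1)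
    (al1al1 : al1 * al1^*%C = k2 + s1 * s12 + (s1 * s12)^-1)
    (E1 : al1 + a^*%C = a2 + al^*%C)
    (E2 : al1 * (s * s1) + a^*%C * (s1 * s12) =
          a2 * (s * s2) + al^*%C * (s2 * s12))
    (E3 : al * a^*%C - a2^*%C * al1 =
          s * s2 + (s * s1)^-1 - s2 * s12 - (s1 * s12)^-1)
    (fr : moving_frame P dP f n) (fr1 : moving_frame P1 dP1 f1 n1)
    (fr2 : moving_frame P2 dP2 f2 n2) (fr12 : moving_frame P12 dP12 f12 n12)
    (stL : lax_step a (s * s1) la P dP P1 dP1)
    (stM : lax_step al (s * s2) la P dP P2 dP2)
    (stM1 : lax_step al1 (s1 * s12) la P1 dP1 P12 dP12)
    (stL2 : lax_step a2 (s2 * s12) la P2 dP2 P12 dP12) :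
  dot (n12 - n) (n12 - n) * dot (n2 - n1) (n2 - n1)
  - dot (n12 - n) (n2 - n1) ^+ 2
  + (dot (f12 - f) (n12 - n) * dot (f2 - f1) (n2 - n1)
     - dot (f12 - f) (n2 - n1) * dot (f2 - f1) (n12 - n)) = 0.
Proof.
have i2 := mulcii R.
have [UP xP yP] := fr; have [UP1 xP1 yP1] := fr1.
have [UP2 xP2 yP2] := fr2; have [UP12 xP12 yP12] := fr12.
have [UL eL edL] := stL; have [UM eM edM] := stM.
have [UM1 eM1 edM1] := stM1; have [UL2 eL2 edL2] := stL2.
have ssJ := @conjc_invM R.
have [cL D1 nL fL] := edge_transport laR la0 (ssJ _ _ sJ s1J) (mulf_neq0 s0 s10)
  aa UP UL eL edL xP xP1 yP yP1.
have [cM D2 nM fM] := edge_transport laR la0 (ssJ _ _ sJ s2J) (mulf_neq0 s0 s20)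
  alal UP UM eM edM xP xP2 yP yP2.
have [cM1 _ nM1 fM1] := edge_transport laR la0 (ssJ _ _ s1J s12J)
  (mulf_neq0 s10 s120) al1al1 UP1 UM1 eM1 edM1 xP1 xP12 yP1 yP12.
have [cL2 _ nL2 fL2] := edge_transport laR la0 (ssJ _ _ s2J s12J)
  (mulf_neq0 s20 s120) a2a2 UP2 UL2 eL2 edL2 xP2 xP12 yP2 yP12.
pose x := la ^+ 2 + la ^- 2; rewrite -/x in D1 D2 nL nM nM1 nL2 fL fM fM1 fL2.
pose p := al1 + a^*%C; pose q := al1 * (s * s1) + a^*%C * (s1 * s12).
pose pZ := a - al; pose qZ := s * (s2 * a - s1 * al).
have D12 : (k1 + x) * (k2 + x) != 0 by rewrite mulf_neq0.
have DL := edge_norm laR la0 (ssJ _ _ sJ s1J) (mulf_neq0 s0 s10) aa.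
have DM := edge_norm laR la0 (ssJ _ _ sJ s2J) (mulf_neq0 s0 s20) alal.
have DM1 := edge_norm laR la0 (ssJ _ _ s1J s12J) (mulf_neq0 s10 s120) al1al1.
rewrite -/x in DL DM DM1.
pose b := 'i%C * (la - s * s1 / la); pose db := 'i%C * (la + s * s1 / la).
pose be := 'i%C * (la - s * s2 / la); pose dbe := 'i%C * (la + s * s2 / la).
pose be1 := 'i%C * (la - s1 * s12 / la); pose dbe1 := 'i%C * (la + s1 * s12 / la).
(* the diagonal from f to f12, with transport M1 L *)
have [uu fu] : (dot (n12 - n) (n12 - n))%:C =
    4%:R * ((la * p - q / la) * (la * p^*%C - q^*%C / la)) / ((k1 + x) * (k2 + x)) /\
    (dot (f12 - f) (n12 - n))%:C =
    4%:R * 'i%C * (q * p^*%C - p * q^*%C) / ((k1 + x) * (k2 + x)).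
  have eW : 1 *: P12 =
      quat (al1 * a - be1 * b^*%C) (al1 * b + be1 * a^*%C) *m P.
    by rewrite -quatM scale1r eM1 eL mulmxA.
  have edW : 0 *: P12 + 1 *: dP12 =
     quat (0 * a - dbe1 * b^*%C + (al1 * 0 - be1 * db^*%C))
        (0 * b + dbe1 * a^*%C + (al1 * db + be1 * 0^*%C)) *m P +
     quat (al1 * a - be1 * b^*%C) (al1 * b + be1 * a^*%C) *m dP.
    rewrite -quatD -!quatM scale1r scale0r add0r edM1 eL edL.
    by rewrite mulmxDr mulmxDl !mulmxA addrA.
  apply: (diagonal_transport laR la0 _ _ _ (oner_neq0 _) UP _ eW edW xP xP12 yP yP12).
  - by rewrite quat_normM mulrC -DL -DM1.
  - by rewrite /p /q /be1 /b; field; rewrite la0.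
  - by rewrite /p /q /be1 /b /dbe1 /db; field; rewrite la0.
  - by rewrite -quatM unitmx_mul UM1 UL.
(* the diagonal from f1 to f2, with transport M L^* *)
have [vv gv] : (dot (n2 - n1) (n2 - n1))%:C =
    4%:R * ((la * pZ - qZ / la) * (la * pZ^*%C - qZ^*%C / la)) / ((k1 + x) * (k2 + x)) /\
    (dot (f2 - f1) (n2 - n1))%:C =
    4%:R * 'i%C * (qZ * pZ^*%C - pZ * qZ^*%C) / ((k1 + x) * (k2 + x)).
  have LL := quat_starl a b; rewrite DL in LL.
  have dLL : quat 0 (- db) *m quat a b + quat a^*%C (- b) *m quat 0 db =
      (b * db^*%C + db * b^*%C)%:M.
    exact: quat_star_derivation.
  have [eZ edZ] := opposite_step LL dLL eL edL eM edM.
  rewrite quatM in eZ; rewrite !quatM quatD in edZ.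
  have UZ : quat al be *m quat a^*%C (- b) \in unitmx.
    by rewrite unitmx_mul UM; exact: quat_star_unit UL.
  rewrite quatM in UZ.
  apply: (diagonal_transport laR la0 _ _ _ D1 UP1 UZ eZ edZ xP1 xP2 yP1 yP2).
  - by rewrite quat_normM quat_star_norm mulrC -DL -DM.
  - by rewrite /pZ /qZ /be /b !conjcE; field; rewrite la0.
  - by rewrite /pZ /qZ /be /b /dbe /db !conjcE; field; rewrite la0.
have [mix mixE] := mixed_diagonals cL cM cM1 cL2.
have E1c := congr1 (@conjc R) E1; rewrite !conjcE in E1c.
have E2c := congr1 (@conjc R) E2.
rewrite !conjcE sJ s1J s2J s12J -!invfM in E2c.
have k1J : k1^*%C = k1.
  have -> : k1 = a * a^*%C - s * s1 - (s * s1)^-1 by rewrite aa; ring.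
  by rewrite !conjcE sJ s1J; field; rewrite s0 s10.
have k2J : k2^*%C = k2.
  have -> : k2 = al * al^*%C - s * s2 - (s * s2)^-1 by rewrite alal; ring.
  by rewrite !conjcE sJ s2J; field; rewrite s0 s20.
have hE := diagonal_product s0 s10 s20 s120 E1c E3 aa al1al1; rewrite -/p -/pZ in hE.
have gE := diagonal_cross_sum s0 s10 s20 s120 E1c E2c E3 aa al1al1.
rewrite -/p -/q -/pZ -/qZ in gE.
have E4 := diagonal_conj_product s0 s10 s20 E1 E2; rewrite -/p -/q in E4.
have {}E4 : p * pZ^*%C = q * qZ^*%C.
  rewrite /pZ /qZ !conjcE E4 sJ s1J s2J; congr (_ * (_ * _)); ring.
have E4c : p^*%C * pZ = q^*%C * qZ.
  by rewrite -[pZ]conjcK -[qZ]conjcK -!conjcME E4.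
have hEc : p^*%C * pZ^*%C =
    k1 - k2 + (s * s1)^-1 - (s * s2)^-1 + (s2 * s12)^-1 - (s1 * s12)^-1.
  by rewrite -conjcME hE !conjcE k1J k2J sJ s1J s2J s12J -!invfM.
have gEc : p^*%C * qZ^*%C + q^*%C * pZ^*%C =
    k1 * ((s * s2)^-1 + (s1 * s12)^-1) - k2 * ((s * s1)^-1 + (s2 * s12)^-1).
  by rewrite -!conjcME -conjcDE gE !conjcE k1J k2J sJ s1J s2J s12J -!invfM.
have spec := spectral_identity la0 E4 E4c; rewrite hE gE hEc gEc -/x in spec.
rewrite mix; apply: (@complexI R).
rewrite expr2 rmorphD !rmorphB !rmorphM /=.
have uvE : dot (n12 - n) (n2 - n1) = dot n2 n12 - dot n1 n12 - dot n n2 + dot n n1.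
  by rewrite !dotE3 !mxE; ring.
pose K := (s * s2 - (s * s2)^-1) / (k2 + x) + (s1 * s12 - (s1 * s12)^-1) / (k2 + x)
  - (s * s1 - (s * s1)^-1) / (k1 + x) - (s2 * s12 - (s2 * s12)^-1) / (k1 + x).
have fvE : 'i%C * (dot (f12 - f) (n2 - n1))%:C = - (2%:R * K).
  transitivity ('i%C * (2%:R^-1 * (2%:R * dot (f12 - f) (n2 - n1))%:C)).
    by rewrite rmorphM rmorph_nat /=; field.
  rewrite mixE !(rmorphD, rmorphN) /= fL fM fM1 fL2.
  transitivity (2%:R * ('i%C * 'i%C) * K).
    rewrite /K; move: ((k1 + x)^-1) ((k2 + x)^-1) => c1 c2.
    by field; rewrite ?s0 ?s10 ?s20 ?s120.
  by rewrite i2; ring.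
apply: (gram_of_products D12 i2 uu vv fu gv _ _ spec).
- rewrite uvE fvE !(rmorphD, rmorphN) /= nL nM nM1 nL2 /K.
  by field; rewrite ?s0 ?s10 ?s20 ?s120 ?D1 ?D2.
- rewrite uvE fvE !(rmorphD, rmorphN) /= nL nM nM1 nL2 /K.
  by field; rewrite ?s0 ?s10 ?s20 ?s120 ?D1 ?D2.
Qed.

(** * Circles at spectral parameter one *)

Lemma real_of_conj (R : realType) (x : R[i]) : x^*%C = x -> exists r : R, x = r%:C.
Proof.
case: x => a b /eqP; rewrite eq_complex /= eqxx /= => /eqP b0; exists a.
by apply/eqP; rewrite eq_complex /= eqxx /=; apply/eqP; lra.
Qed.

Lemma quat_norm_conj (R : realType) (w v : R[i]) :
  (w * w^*%C + v * v^*%C)^*%C = w * w^*%C + v * v^*%C.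
Proof. by rewrite !conjcE; ring. Qed.

Lemma mulmx_conj_step (K : comUnitRingType) (P Q S A B E F : 'M[K]_2) (c d : K) :
  Q \in unitmx -> E = c *: (invmx P *m A *m Q) -> F = d *: (invmx Q *m B *m S) ->
  E *m F = (c * d) *: (invmx P *m (A *m B) *m S).
Proof.
by move=> UQ -> ->; rewrite -scalemxAl -scalemxAr scalerA !mulmxA mulmxK.
Qed.

Lemma scale_mulmx_cross (K : fieldType) (E F W W' P S : 'M[K]_2) (c d r : K) :
  d != 0 -> E = c *: (P *m W *m S) -> F = d *: (P *m W' *m S) ->
  W = r *: W' -> E = (c * r / d) *: F.
Proof.
by move=> d0 -> -> ->; rewrite scalerA divfK // -scalemxAr -scalemxAl scalerA.
Qed.

(** At la = 1 the number b db^* is imaginary, where b is the off-diagonal entry of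
    the Lax matrix X and db its derivative; this makes X^-1 dX trace-free and equal
    to dX X up to the norm of X. *)
Lemma edge_at_one (R : realType) (a sigma : R[i]) (P dP Pp dPp : 'M[R[i]]_2)
    (x xp y yp : 'rV[R]_3) :
  sigma^*%C = sigma^-1 -> sigma != 0 ->
  moving_frame P dP x y -> moving_frame Pp dPp xp yp ->
  lax_step a sigma 1 P dP Pp dPp ->
  exists2 c : R, c != 0 &
    iquat (xp - x) = c%:C *: (invmx P *m quat 0 ('i%C * (1 + sigma)) *m Pp).
Proof.
move=> sJ s0 [UP hx _] [UPp hxp _]; rewrite /lax_step /edge_quat !divr1.
set b := 'i%C * (1 - sigma); set db := 'i%C * (1 + sigma) => -[UX eP edP].
have bdb : b * db^*%C = - (db * b^*%C).
  rewrite /b /db !conjcE sJ; apply/subr0_eq.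
  by field; rewrite s0.
have eP' : 1 *: Pp = quat a b *m P by rewrite scale1r.
have edP' : 0 *: Pp + 1 *: dPp = quat 0 db *m P + quat a b *m dP.
  by rewrite scale1r scale0r add0r.
have D0 := quat_unit_norm UX.
have [d dE] : exists d : R, a * a^*%C + b * b^*%C = d%:C.
  exact/real_of_conj/quat_norm_conj.
have d0 : d != 0 by apply: contra D0 => /eqP d0; rewrite dE d0.
have XdX : invmx (quat a b) *m quat 0 db = d^-1%:C *: (quat 0 db *m quat a b).
  rewrite invmx_quat // dE -scalemxAl -fmorphV; congr (_ *: _).
  rewrite !quatM conjc0 !(mulr0, mul0r) addr0 add0r !sub0r mulNr opprK bdb.
  by rewrite add0r (mulrC db a^*%C).
exists (2%:R / d); first by rewrite mulf_neq0 ?invr_eq0 ?pnatr_eq0.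
rewrite iquatB hx hxp /frame_position -scalerBr.
have tfB (A B : 'M[R[i]]_2) : trace_free_part A - trace_free_part B =
    trace_free_part (A - B).
  rewrite /trace_free_part [\tr (A - B)]raddfB /=; apply/matrixP => i j.
  by rewrite !mxE; case: (i == j) => /=; rewrite ?mulr1n ?mulr0n; field.
rewrite tfB (transport_velocity (oner_neq0 _) UP UX eP' edP').
rewrite invr1 mul1r -[0%:M]scalemx1 scale0r subr0 addrAC subrr add0r XdX.
have tr0 : \tr (invmx P *m (d^-1%:C *: (quat 0 db *m quat a b)) *m P) = 0.
  rewrite mxtrace_conj // mxtraceZ quatM mxtrace_mx2 mul0r sub0r.
  have cj (u v : R[i]) : (- (u * v^*%C))^*%C = - (v * u^*%C).
    by rewrite !conjcE mulrC.
  by rewrite cj bdb opprK addNr mulr0.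
rewrite /trace_free_part tr0 mul0r -[0%:M]scalemx1 scale0r subr0.
rewrite -scalemxAr -scalemxAl scalerA rmorphM rmorph_nat; congr (_ *: _).
by rewrite eP !mulmxA.
Qed.

(** The corner products have first entries - w and - w', and conjugation multiplies
    both w and w' by s12 / s; so their ratio is real. *)
Lemma face_concyclic (R : realType) (s s1 s2 s12 a al a2 al1 : R[i])
    (P dP P1 dP1 P2 dP2 P12 dP12 : 'M[R[i]]_2)
    (f f1 f2 f12 n n1 n2 n12 : 'rV[R]_3)
    (s0 : s != 0) (s10 : s1 != 0) (s20 : s2 != 0) (s120 : s12 != 0)
    (sJ : s^*%C = s^-1) (s1J : s1^*%C = s1^-1)
    (s2J : s2^*%C = s2^-1) (s12J : s12^*%C = s12^-1)
    (fr : moving_frame P dP f n) (fr1 : moving_frame P1 dP1 f1 n1)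
    (fr2 : moving_frame P2 dP2 f2 n2) (fr12 : moving_frame P12 dP12 f12 n12)
    (stL : lax_step a (s * s1) 1 P dP P1 dP1)
    (stM : lax_step al (s * s2) 1 P dP P2 dP2)
    (stM1 : lax_step al1 (s1 * s12) 1 P1 dP1 P12 dP12)
    (stL2 : lax_step a2 (s2 * s12) 1 P2 dP2 P12 dP12) :
  on_circle_or_line f f1 f12 f2.
Proof.
have i2 := mulcii R.
have ssJ := @conjc_invM R.
have [c c0 e] := edge_at_one (ssJ _ _ sJ s1J) (mulf_neq0 s0 s10) fr fr1 stL.
have [c1 c10 e1] := edge_at_one (ssJ _ _ s1J s12J) (mulf_neq0 s10 s120) fr1 fr12 stM1.
have [d d0 g] := edge_at_one (ssJ _ _ sJ s2J) (mulf_neq0 s0 s20) fr fr2 stM.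
have [d1 d10 g1] := edge_at_one (ssJ _ _ s2J s12J) (mulf_neq0 s20 s120) fr2 fr12 stL2.
have [UP _ _] := fr; have [UP1 _ _] := fr1; have [UP2 _ _] := fr2.
have corner (x y : R[i]) : y^*%C = y^-1 ->
    quat 0 ('i%C * (1 + x)) *m quat 0 ('i%C * (1 + y)) =
    quat (- ((1 + x) * (1 + y^-1))) 0.
  move=> yJ; rewrite quatM; congr quat; last by rewrite conjc0; ring.
  rewrite !conjcE yJ; apply/subr0_eq.
  transitivity (('i%C * 'i%C + 1) * ((1 + x) * (1 + y^-1))); first by ring.
  by rewrite i2 addNr mul0r.
have AB : iquat (f1 - f) *m iquat (f12 - f1) = (c * c1)%:C *:
    (invmx P *m quat (- ((1 + s * s1) * (1 + (s1 * s12)^-1))) 0 *m P12).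
  have -> : (c * c1)%:C = c%:C * c1%:C by rewrite rmorphM.
  rewrite -(corner (s * s1) _ (ssJ _ _ s1J s12J)).
  exact: mulmx_conj_step UP1 e e1.
have CD : iquat (f2 - f) *m iquat (f12 - f2) = (d * d1)%:C *:
    (invmx P *m quat (- ((1 + s * s2) * (1 + (s2 * s12)^-1))) 0 *m P12).
  have -> : (d * d1)%:C = d%:C * d1%:C by rewrite rmorphM.
  rewrite -(corner (s * s2) _ (ssJ _ _ s2J s12J)).
  exact: mulmx_conj_step UP2 g g1.
set w := (1 + s * s1) * (1 + (s1 * s12)^-1) in AB.
set w' := (1 + s * s2) * (1 + (s2 * s12)^-1) in CD.
have sum : (f1 - f) + (f12 - f1) = (f2 - f) + (f12 - f2).
  by rewrite [LHS]addrC subrKA [RHS]addrC subrKA.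
(* w' = 0 means that an edge at f2 vanishes: the roles are then exchanged *)
have [w'0|w'0] := eqVneq w' 0.
  have CD0 : iquat (f2 - f) *m iquat (f12 - f2) =
      0%:C *: (iquat (f1 - f) *m iquat (f12 - f1)).
    rewrite CD w'0 oppr0 [RHS]scale0r.
    by rewrite /quat !conjcE oppr0 mx2_0 mulmx0 mul0mx scaler0.
  have [C [hC [h1 h2 h3 h4]]] := on_circle_or_line_of_product f (esym sum) CD0.
  by exists C; move: h1 h2 h3 h4; rewrite !subrKC.
have [r rE] : exists r : R, w / w' = r%:C.
  apply: real_of_conj; rewrite conjcME conjcVE.
  have wJ : w^*%C = s12 / s * w.
    by rewrite /w !conjcE sJ s1J s12J; field; rewrite ?s0 ?s10 ?s120.
  have w'J : w'^*%C = s12 / s * w'.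
    by rewrite /w' !conjcE sJ s2J s12J; field; rewrite ?s0 ?s20 ?s120.
  by rewrite wJ w'J; field; rewrite ?s0 ?s120 ?w'0.
have ABr : iquat (f1 - f) *m iquat (f12 - f1) =
    (c * c1 * r / (d * d1))%:C *: (iquat (f2 - f) *m iquat (f12 - f2)).
  have wE : quat (- w) 0 = r%:C *: quat (- w') 0.
    by rewrite quatZ mulr0 mulrN -rE divfK.
  have -> : (c * c1 * r / (d * d1))%:C = (c * c1)%:C * r%:C / (d * d1)%:C.
    by rewrite rmorphM fmorphV rmorphM.
  apply: scale_mulmx_cross AB CD wE.
  by rewrite fmorph_eq0 mulf_neq0.
have [C [hC [h1 h2 h3 h4]]] := on_circle_or_line_of_product f sum ABr.
by exists C; move: h1 h2 h3 h4; rewrite !subrKC.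
Qed.

(** * The associated family of nets *)

Lemma lax_step_exp (R : realType) (a sigma : R[i]) (X Phi Phi1 : R -> 'M[R[i]]_2)
    (t : R) :
  (forall lambda, X lambda = edge_quat a sigma lambda%:C) ->
  (forall lambda, 0 < lambda -> Phi1 lambda = X lambda *m Phi lambda) ->
  mx_smooth_pos Phi -> Phi1 (expR t) \in unitmx ->
  lax_step a sigma (expR t)%:C
    (Phi (expR t)) (mx_derive (fun u => Phi (expR u)) t)
    (Phi1 (expR t)) (mx_derive (fun u => Phi1 (expR u)) t).
Proof.
move=> XE e sm U; have et := e _ (expR_gt0 t); rewrite XE in et.
split=> //; first by move: U; rewrite et unitmx_mul => /andP[].
have -> : (fun u => Phi1 (expR u)) =
    (fun u => edge_quat a sigma (expR u)%:C *m Phi (expR u)).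
  by apply/funext => u; rewrite e ?expR_gt0 // XE.
apply/mx_derive_val/mx_is_deriveM; first exact: edge_quat_is_derive.
exact: mx_smooth_is_derive_exp.
Qed.

Unset Implicit Arguments.

Theorem theorem2p4 (R : realType) (s l m : int -> int -> R[i])
    (delta1 delta2 : int -> R[i]) (Phi : int -> int -> R -> 'M[R[i]]_2)
    (f n : R -> net R)
    (hdata : lax_data s l m delta1 delta2)
    (hcompat : forall (j k : int) (lambda : R), 0 < lambda ->
       laxM s m delta2 (j + 1) k lambda *m laxL s l delta1 j k lambda
       = laxL s l delta1 j (k + 1) lambda *m laxM s m delta2 j k lambda)
    (hPhi1 : forall (j k : int) (lambda : R), 0 < lambda ->
       Phi (j + 1) k lambda = laxL s l delta1 j k lambda *m Phi j k lambda)
    (hPhi2 : forall (j k : int) (lambda : R), 0 < lambda ->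
       Phi j (k + 1) lambda = laxM s m delta2 j k lambda *m Phi j k lambda)
    (hPhiq : forall (j k : int) (lambda : R), 0 < lambda ->
       quaternion (Phi j k lambda) /\ Phi j k lambda <> 0)
    (hPhis : forall j k : int, mx_smooth_pos (Phi j k))
    (hf : forall (t : R) (j k : int),
       iquat (f t j k) = 2%:R *: trace_free_part
         (invmx (Phi j k (expR t)) *m mx_derive (fun u => Phi j k (expR u)) t))
    (hn : forall (t : R) (j k : int),
       iquat (n t j k) =
         - 'i%C *: (invmx (Phi j k (expR t)) *m sigma3 R *m Phi j k (expR t))) :
  (forall t : R, has_gauss_curvature (f t) (n t) (- 1)) /\
  (forall t : R, expR t = 1 -> circular_net (f t)).
Proof.
have UPhi j k lambda : 0 < lambda -> Phi j k lambda \in unitmx.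
  move=> l0; have [/quaternionP[w [v ->]]] := hPhiq j k _ l0.
  exact: quat_neq0_unit.
have [hs hl hm hd1 hd2 hLq hMq _ _] := hdata.
have s0 j k : s j k != 0 by rewrite -normr_eq0 hs oner_eq0.
have sJ j k : (s j k)^*%C = (s j k)^-1.
  by rewrite invc_norm hs expr1n invr1 mul1r.
have ssJ := @conjc_invM R.
have LE j k := lax_matrix_edge_quat (hd1 j) (hl j k) (hs j k) (hs (j + 1) k) (hLq j k).
have ME j k := lax_matrix_edge_quat (hd2 k) (hm j k) (hs j k) (hs j (k + 1)) (hMq j k).
have frame t j k : moving_frame (Phi j k (expR t))
    (mx_derive (fun u => Phi j k (expR u)) t) (f t j k) (n t j k).
  by split; [exact/UPhi/expR_gt0 | exact: hf | exact: hn].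
have stepL t j k a : (forall lambda, laxL s l delta1 j k lambda =
      edge_quat a (s j k * s (j + 1) k) lambda%:C) ->
    lax_step a (s j k * s (j + 1) k) (expR t)%:C
      (Phi j k (expR t)) (mx_derive (fun u => Phi j k (expR u)) t)
      (Phi (j + 1) k (expR t)) (mx_derive (fun u => Phi (j + 1) k (expR u)) t).
  move=> aE; apply: lax_step_exp aE _ (hPhis j k) (UPhi _ _ _ (expR_gt0 t)).
  exact: hPhi1.
have stepM t j k a : (forall lambda, laxM s m delta2 j k lambda =
      edge_quat a (s j k * s j (k + 1)) lambda%:C) ->
    lax_step a (s j k * s j (k + 1)) (expR t)%:C
      (Phi j k (expR t)) (mx_derive (fun u => Phi j k (expR u)) t)
      (Phi j (k + 1) (expR t)) (mx_derive (fun u => Phi j (k + 1) (expR u)) t).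
  move=> aE; apply: lax_step_exp aE _ (hPhis j k) (UPhi _ _ _ (expR_gt0 t)).
  exact: hPhi2.
have la0 t : (expR t)%:C != 0 :> R[i].
  by rewrite fmorph_eq0 gt_eqF ?expR_gt0.
split=> [t|t t1].
- split=> [j k|j k N rk fN den].
  + have [a [aa aE]] := LE j k; have [b [bb bE]] := ME j k.
    have [UP hx hy] := frame t j k.
    have [_ hx1 hy1] := frame t (j + 1) k; have [_ hx2 hy2] := frame t j (k + 1).
    have [UL eL edL] := stepL t j k a aE; have [UM eM edM] := stepM t j k b bE.
    have [cL _ _ _] := edge_transport (conjc_real _) (la0 t) (ssJ _ _ (sJ j k) (sJ _ _))
      (mulf_neq0 (s0 _ _) (s0 _ _)) aa UP UL eL edL hx hx1 hy hy1.
    have [cM _ _ _] := edge_transport (conjc_real _) (la0 t) (ssJ _ _ (sJ j k) (sJ _ _))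
      (mulf_neq0 (s0 _ _) (s0 _ _)) bb UP UM eM edM hx hx2 hy hy2.
    by split => //; exact: frame_normal_unit UP hy.
  + apply: curvature_of_gram rk fN den.
    have [a [aa aE]] := LE j k; have [al [alal alE]] := ME j k.
    have [a2 [a2a2 a2E]] := LE j (k + 1); have [al1 [al1al1 al1E]] := ME (j + 1) k.
    (* the value t = 0 corresponds to la = 1 *)
    have U1 : edge_quat a (s j k * s (j + 1) k) 1 \in unitmx.
      have [+ _ _] := stepL 0 j k a aE; by rewrite expR0.
    have [E1 E2 E3] : _ := face_relations (s0 _ _) (s0 _ _) (s0 _ _) (s0 _ _)
      (sJ _ _) (sJ _ _) (sJ _ _) (sJ _ _) aa a2a2 U1
      (fun lambda l0 => etrans (esym (congr2 mulmx (al1E lambda) (aE lambda)))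
         (etrans (hcompat j k lambda l0) (congr2 mulmx (a2E lambda) (alE lambda)))).
    exact: (face_gram_identity (conjc_real _) (la0 t) (s0 _ _) (s0 _ _) (s0 _ _) (s0 _ _)
      (sJ _ _) (sJ _ _) (sJ _ _) (sJ _ _) aa alal a2a2 al1al1 E1 E2 E3
      (frame t j k) (frame t (j + 1) k) (frame t j (k + 1)) (frame t (j + 1) (k + 1))
      (stepL t j k a aE) (stepM t j k al alE) (stepM t (j + 1) k al1 al1E)
      (stepL t j (k + 1) a2 a2E)).
- move=> j k.
  have [a [_ aE]] := LE j k; have [al [_ alE]] := ME j k.
  have [a2 [_ a2E]] := LE j (k + 1); have [al1 [_ al1E]] := ME (j + 1) k.
  have la1 : (expR t)%:C = 1 :> R[i] by rewrite t1 rmorph1.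
  have sL := stepL t j k a aE; have sM := stepM t j k al alE.
  have sM1 := stepM t (j + 1) k al1 al1E; have sL2 := stepL t j (k + 1) a2 a2E.
  rewrite la1 in sL sM sM1 sL2.
  exact: (face_concyclic (s0 _ _) (s0 _ _) (s0 _ _) (s0 _ _)
    (sJ _ _) (sJ _ _) (sJ _ _) (sJ _ _)
    (frame t j k) (frame t (j + 1) k) (frame t j (k + 1)) (frame t (j + 1) (k + 1))
    sL sM sM1 sL2).
Qed.
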